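(* Let $M\le\min\{P,K\}$, let $p_0>0$, let $\mathbf H\in\mathbb C^{P\times K}$ with $\operatorname{rank}(\mathbf H)\ge M$, and let $\mathbf R_{vv}\in\mathbb C^{P\times P}$ be Hermitian positive definite. Let $\mathbf H^H\mathbf R_{vv}^{-1}\mathbf H=\mathbf V\boldsymbol\Lambda\mathbf V^H$ be the eigenvalue decomposition with eigenvalues $\lambda_1\ge\cdots\ge\lambda_K$ on the diagonal of $\boldsymbol\Lambda$, let $\tilde{\mathbf V}_M$ be the first $M$ columns of $\mathbf V$, and let $\tilde{\boldsymbol\Lambda}_M=\operatorname{diag}(\lambda_1,\dots,\lambda_M)$. The arithmetic mean-square error $\operatorname{tr}(\mathbf R_{ee})/M$ of a block-by-block transceiver with a ZF-BDFD and power bound $p_0$ achieves its minimized lower bound $$\frac{M}{p_0}\Bigl(\prod_{i=1}^M\lambda_i\Bigr)^{-1/M}$$ when the precoder is $$\mathbf F=\sqrt{\tfrac{p_0}{M}}\;\tilde{\mathbf V}_M\boldsymbol\Psi_{\rm ZF},$$ where $\boldsymbol\Psi_{\rm ZF}$ is the $M\times M$ unitary matrix obtained by applying Algorithm A (given in the context) to $\boldsymbol\Gamma=\tilde{\boldsymbol\Lambda}_M^{1/2}$. The corresponding feedback matrix is $\mathbf B=\mathbf U-\mathbf I$, where $\mathbf U$ is the unit-diagonal upper-triangular matrix $$\mathbf U=\Bigl(\prod_{i=1}^M\lambda_i\Bigr)^{-1/(2M)}\bar{\mathbf U},$$ and $\bar{\mathbf U}$ is the upper-triangular factor in the QR decomposition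 $\tilde{\boldsymbol\Lambda}_M^{1/2}\boldsymbol\Psi_{\rm ZF}=\mathbf Q\bar{\mathbf U}$ ($\mathbf Q$ unitary). The corresponding feedforward matrix is $$\mathbf W=(\mathbf B+\mathbf I)\bigl(\mathbf R_{vv}^{-1/2}\mathbf H\mathbf F\bigr)^+\mathbf R_{vv}^{-1/2}.$$
   Context: All matrices are complex; $(\cdot)^H$ is the conjugate transpose, $(\cdot)^+$ the Moore–Penrose pseudo-inverse. Model. The received block is $\mathbf y=\mathbf H\mathbf F\mathbf s+\mathbf v$ with $E[\mathbf s\mathbf s^H]=\mathbf I$, $E[\mathbf s\mathbf v^H]=\mathbf 0$, $E[\mathbf v\mathbf v^H]=\mathbf R_{vv}$. A ZF-BDFD (zero-forcing intra-block decision feedback detector) transceiver with power bound $p_0$ is a triple $(\mathbf F,\mathbf B,\mathbf W)$ with precoder $\mathbf F\in\mathbb C^{K\times M}$, strictly upper-triangular feedback matrix $\mathbf B\in\mathbb C^{M\times M}$ and feedforward matrix $\mathbf W\in\mathbb C^{M\times P}$ such that $\operatorname{tr}(\mathbf F\mathbf F^H)\le p_0$ and $\mathbf W\mathbf H\mathbf F=\mathbf B+\mathbf I$. Assuming correct past decisions, the error at the decision point is $\mathbf e=(\mathbf W\mathbf H\mathbf F-\mathbf I-\mathbf B)\mathbf s+\mathbf W\mathbf v$, whose covariance in the zero-forcing case is $\mathbf R_{ee}=\mathbf W\mathbf R_{vv}\mathbf W^H$. ''Minimized lower bound'' means that the displayed value is a lower bound on $\operatorname{tr}(\mathbf R_{ee})/M$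 for every ZF-BDFD transceiver with power bound $p_0$ (it is the arithmetic–geometric mean lower bound $|\mathbf R_{ee}|^{1/M}$, minimized over precoders satisfying the power bound). Algorithm A. Input: a diagonal non-singular $M\times M$ matrix $\boldsymbol\Gamma$ with positive diagonal elements $\gamma_1\ge\cdots\ge\gamma_M$. Output: an $M\times M$ unitary matrix $\mathbf S$, with entries $s_{\ell k}$ and $k$th column $[\mathbf S]_{\cdot k}$, intended to make all diagonal elements of the R-factor of the QR decomposition of $\boldsymbol\Gamma\mathbf S$ equal to $(\prod_k\gamma_k)^{1/M}$. Notation: $g=(\prod_{k=1}^M\gamma_k^2)^{1/M}$; $\mathbf Z_k$ is the matrix of the first $k$ columns of $\mathbf S$; $\mathbf Z_k^\perp$ is an $M\times(M-k)$ matrix whose orthonormal columns span the orthogonal complement of the columns of $\mathbf Z_k$; $\mathcal P_{\mathbf A}=\mathbf I-\mathbf A(\mathbf A^H\mathbf A)^{-1}\mathbf A^H$; and $\mathbf A^{(k)}=(\boldsymbol\Gamma\mathbf Z_k^\perp)^H\mathcal P_{(\boldsymbol\Gamma\mathbf Z_k)}\boldsymbol\Gamma\mathbf Z_k^\perp$, of size $(M-k)\times(M-k)$. 1. Set $k=1$; $s_{11}=\sqrt{\frac{g-\gamma_M^2}{\gamma_1^2-\gamma_M^2}}$, $s_{M1}=\sqrt{\frac{\gamma_1^2-g}{\gamma_1^2-\gamma_M^2}}$, $s_{\ell1}=0$ for $2\le\ell\le M-1$. 2. Form $\mathbf A^{(k)}$ and its eigendecomposition $\mathbf A^{(k)}=\mathbf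 V^{(k)}\boldsymbol\Lambda^{(k)}(\mathbf V^{(k)})^H$, eigenvalues $\lambda^{(k)}_1\ge\cdots\ge\lambda^{(k)}_{M-k}$. 3. Set $[\mathbf S]_{\cdot k+1}=\mathbf Z_k^\perp\mathbf V^{(k)}\mathbf y^{(k)}$, where $y^{(k)}_1=\sqrt{\frac{g-\lambda^{(k)}_{M-k}}{\lambda^{(k)}_1-\lambda^{(k)}_{M-k}}}$, $y^{(k)}_{M-k}=\sqrt{\frac{\lambda^{(k)}_1-g}{\lambda^{(k)}_1-\lambda^{(k)}_{M-k}}}$, and $y^{(k)}_\ell=0$ for $2\le\ell\le M-k-1$. 4. Increment $k$. If $k\le M-2$ return to step 2. Otherwise set $[\mathbf S]_{\cdot M}=\mathbf Z_{M-2}^\perp\mathbf V^{(M-2)}\mathbf y^{(M-1)}$, where $y^{(M-1)}_1=-\sqrt{\frac{\lambda^{(M-2)}_1-g}{\lambda^{(M-2)}_1-\lambda^{(M-2)}_2}}$, $y^{(M-1)}_2=\sqrt{\frac{g-\lambda^{(M-2)}_2}{\lambda^{(M-2)}_1-\lambda^{(M-2)}_2}}$.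
   Formalization: Where Algorithm A is undefined it is completed: a coefficient pair of the form 0/0 (equal extreme eigenvalues, in particular M=1, where S=[1]) is read as (1,0), and for M=2 step 4 uses Z_0^⊥=I, V^(0)=I, λ^(0)=γ². The R-factor of the QR decomposition has nonnegative diagonal. *)

(* Defs.v *)
(* The matrix notions are stated over any numClosedFieldType C; the complex
   numbers are the instance C = R[i] with R : realType. *)
From HB Require Import structures.
From mathcomp Require Import all_boot all_order all_algebra.
From mathcomp Require Import sesquilinear spectral complex.
From mathcomp Require Import all_classical all_reals all_analysis.

Set Implicit Arguments.
Unset Strict Implicit.
Unset Printing Implicit Defensive.

Import Order.TTheory GRing.Theory Num.Theory.

Local Open Scope classical_set_scope.
Local Open Scope ring_scope.
Local Open Scope sesquilinear_scope.

Section Matrices.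
Variable C : numClosedFieldType.

Definition posdefmx n (A : 'M[C]_n) : Prop :=
  A \is hermsymmx /\
  forall u : 'cV[C]_n, u != 0 -> 0 < (u ^t* *m A *m u) 0 0.

(* A^{-1/2} for A positive definite: the positive definite square root of
   A^{-1}. *)
Definition invsqrtmx n (A : 'M[C]_n) : 'M[C]_n :=
  xget 0 [set X : 'M[C]_n | posdefmx X /\ X *m X = invmx A].

(* [pinvmx] of the library is only a partial inverse; the Moore-Penrose
   pseudo-inverse is the unique matrix satisfying the four Penrose equations. *)
Definition penrose m n (A : 'M[C]_(m, n)) (X : 'M[C]_(n, m)) : Prop :=
  [/\ A *m X *m A = A, X *m A *m X = X,
      (A *m X) ^t* = A *m X & (X *m A) ^t* = X *m A].

Definition mp_pinvmx m n (A : 'M[C]_(m, n)) : 'M[C]_(n, m) :=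
  xget 0 [set X : 'M[C]_(n, m) | penrose A X].

(* diag(x_1, ..., x_n); entries of x beyond the n-th are ignored. *)
Definition diag_seq n (x : seq C) : 'M[C]_n := diag_mx (\row_(i < n) x`_i).

(* For Hermitian A the eigenvalues are real, so [>=] on C is the usual order. *)
Definition is_evd n (A V : 'M[C]_n) (lam : seq C) : Prop :=
  [/\ size lam = n, sorted >=%R lam, V \is unitarymx &
      A = V *m diag_seq n lam *m V ^t*].

(* The R-factor is normalised to have a nonnegative diagonal. *)
Definition is_qr n (A Q U : 'M[C]_n) : Prop :=
  [/\ Q \is unitarymx,
      forall i j : 'I_n, (j < i)%N -> U i j = 0,
      forall i : 'I_n, 0 <= U i i &
      A = Q *m U].

Definition orthonormal_complement m k l
    (Z : 'M[C]_(m, k)) (Zp : 'M[C]_(m, l)) : Prop :=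
  Zp ^t* *m Zp = 1%:M /\
  forall u : 'cV[C]_m, Z ^t* *m u = 0 <-> exists c : 'cV[C]_l, u = Zp *m c.

(* The projector onto the orthogonal complement of the columns of A. *)
Definition compl_proj m k (A : 'M[C]_(m, k)) : 'M[C]_m :=
  1%:M - A *m invmx (A ^t* *m A) *m A ^t*.

(* The vector with a in its first entry, b in its last entry, 0 elsewhere. *)
Definition ends_col n (a b : C) : 'cV[C]_n :=
  \col_(i < n) (a *+ (i == 0 :> nat) + b *+ (i == n.-1 :> nat)).

(* sqrt ((g - lo) / (hi - lo)) and sqrt ((hi - g) / (hi - lo)). When hi = lo
   both quotients are 0/0 (then also g = hi = lo, and every unit vector is an
   admissible choice); the pair of values is then taken to be (1, 0). *)
Definition coef_lo (g hi lo : C) : C :=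
  if hi == lo then 1 else sqrtC ((g - lo) / (hi - lo)).
Definition coef_hi (g hi lo : C) : C :=
  if hi == lo then 0 else sqrtC ((hi - g) / (hi - lo)).

Definition cols_mx m k (s : nat -> 'cV[C]_m) : 'M[C]_(m, k) :=
  \matrix_(i < m, j < k) s j i 0.

(* "S is an output of the algorithm on Gamma = diag(gam)", where gam has size
   M: it depends on the choice of the complements Zp k and of the
   eigendecompositions. The column number k + 1 is s k.
   The values of Zp, V and lam at k = 0 are those for which the first column is
   the instance k = 0 of the formula for the others (empty Z_0, Z_0^perp = I,
   A^(0) = Gamma^2, V^(0) = I); they are used only in the last step when M = 2.
   [pid_mx M] is the identity matrix, of type 'M_(M, M - 0). For M = 1 only the
   first step is performed, and its output is the 1 x 1 identity matrix. *)
Definition algorithmA M (gam : seq C) (S : 'M[C]_M) : Prop :=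
  let Gam : 'M[C]_M := diag_seq M gam in
  let g : C := M.-root (\prod_(i < M) gam`_i ^+ 2) in
  exists (s : nat -> 'cV[C]_M)
         (Zp : forall k : nat, 'M[C]_(M, M - k))
         (V : forall k : nat, 'M[C]_(M - k))
         (lam : nat -> seq C),
  let GZ k : 'M[C]_(M, k) := Gam *m cols_mx k s in
  let A k : 'M[C]_(M - k) :=
    (Gam *m Zp k) ^t* *m compl_proj (GZ k) *m (Gam *m Zp k) in
  let hi k : C := (lam k)`_0 in
  let lo k : C := (lam k)`_(M - k).-1 in
  [/\ [/\ Zp 0%N = pid_mx M, V 0%N = 1%:M & lam 0%N = [seq x ^+ 2 | x <- gam]],
      s 0%N = ends_col M (coef_lo g (gam`_0 ^+ 2) (gam`_M.-1 ^+ 2))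
                         (coef_hi g (gam`_0 ^+ 2) (gam`_M.-1 ^+ 2)),
      forall k : nat, (1 <= k <= M - 2)%N ->
        [/\ orthonormal_complement (cols_mx k s) (Zp k),
            is_evd (A k) (V k) (lam k) &
            s k = Zp k *m V k *m
                  ends_col (M - k) (coef_lo g (hi k) (lo k))
                                   (coef_hi g (hi k) (lo k))],
      (2 <= M)%N ->
        let k := (M - 2)%N in
        s M.-1 = Zp k *m V k *m
                 ends_col (M - k) (- coef_hi g (hi k) (lo k))
                                  (coef_lo g (hi k) (lo k)) &
      S = cols_mx M s].

(* (F, B, W) is a zero-forcing block decision feedback transceiver with power
   bound p0 for the channel H. *)
Definition zf_bdfd M K P (H : 'M[C]_(P, K)) (p0 : C)
    (F : 'M[C]_(K, M)) (B : 'M[C]_M) (W : 'M[C]_(M, P)) : Prop :=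
  [/\ forall i j : 'I_M, (j <= i)%N -> B i j = 0,
      \tr (F *m F ^t*) <= p0 &
      W *m H *m F = B + 1%:M].

End Matrices.

Section SecondOrderStatistics.
Context d (T : measurableType d) (R : realType) (Pr : probability T R).

(* A complex random vector with finite second moments. *)
Definition L2_cvector n (x : T -> 'cV[R[i]]_n) : Prop :=
  forall i : 'I_n,
    (fun t => complex.Re (x t i 0)) \in Lfun Pr 2%:E /\
    (fun t => complex.Im (x t i 0)) \in Lfun Pr 2%:E.

Definition cexpectation (Z : T -> R[i]) : R[i] :=
  Complex (fine ('E_Pr[fun t => complex.Re (Z t)])%E)
          (fine ('E_Pr[fun t => complex.Im (Z t)])%E).

(* E[x y^H] *)
Definition corrmx m n (x : T -> 'cV[R[i]]_m) (y : T -> 'cV[R[i]]_n) :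
    'M[R[i]]_(m, n) :=
  \matrix_(i, j) cexpectation (fun t => (x t *m (y t) ^t*) i j).

Variables (M K P : nat) (s : T -> 'cV[R[i]]_M) (v : T -> 'cV[R[i]]_P).
Variables (H : 'M[R[i]]_(P, K)) (F : 'M[R[i]]_(K, M)) (B : 'M[R[i]]_M)
  (W : 'M[R[i]]_(M, P)).

(* The error at the decision point when all past decisions are correct. *)
Definition decision_error (t : T) : 'cV[R[i]]_M :=
  (W *m H *m F - 1%:M - B) *m s t + W *m v t.

Definition arith_mse : R[i] :=
  \tr (corrmx decision_error decision_error) / M%:R.

End SecondOrderStatistics.

(* Main.v *)
Require Import Defs.
From HB Require Import structures.
From mathcomp Require Import all_boot all_order all_algebra.
From mathcomp Require Import fingroup perm.
From mathcomp Require Import sesquilinear spectral complex.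
From mathcomp Require Import all_classical all_reals all_analysis.
From mathcomp Require Import ring.

(* Lower bound: zero forcing cancels the s-part of the error, and for a unit
   upper triangular W H F one has |R_ee| >= |F^H G F|^-1 with
   G = H^H Rvv^-1 H. The eigenvalues of a compression of G to an M-dimensional
   subspace are dominated one by one by lambda_1, ..., lambda_M, so
   |F^H G F| <= (prod lambda_i) |F^H F|, and two applications of the
   arithmetic-geometric mean inequality (to R_ee and to F^H F) conclude.

   Algorithm A: by induction the first k columns Z_k are orthonormal and
   |(Gamma Z_k)^H Gamma Z_k| = g^k. The Schur complement formula then gives
   |A^(k)| = g^(M-k), hence g lies between the extreme eigenvalues of A^(k), the
   vector y^(k) is a real unit vector, and the Rayleigh quotient of A^(k) at
   V^(k) y^(k) equals g, which is the next factor of the Gram determinant. The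
   leading minors g^k of the Gram matrix of Gamma S = Q U force U_kk^2 = g, so
   R_ee is a multiple of the identity and every inequality above is an
   equality. *)

Set Implicit Arguments.
Unset Strict Implicit.
Unset Printing Implicit Defensive.

Import Order.TTheory GRing.Theory Num.Theory.

Local Open Scope ring_scope.
Local Open Scope sesquilinear_scope.

(** * Hermitian matrices and eigenvalue decompositions *)

Section Adjoint.
Variable C : numClosedFieldType.

Lemma ctrM m n p (A : 'M[C]_(m, n)) (B : 'M[C]_(n, p)) :
  (A *m B) ^t* = B ^t* *m A ^t*.
Proof. by rewrite trmx_mul map_mxM. Qed.

Lemma ctrD m n (A B : 'M[C]_(m, n)) : (A + B) ^t* = A ^t* + B ^t*.
Proof. by rewrite linearD /= map_mxD. Qed.

Lemma ctrB m n (A B : 'M[C]_(m, n)) : (A - B) ^t* = A ^t* - B ^t*.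
Proof. by rewrite linearB /= map_mxB. Qed.

Lemma ctrZ m n (a : C) (A : 'M[C]_(m, n)) : (a *: A) ^t* = a^* *: A ^t*.
Proof. by rewrite linearZ /= map_mxZ. Qed.

Lemma ctr0 m n : (0 : 'M[C]_(m, n)) ^t* = 0.
Proof. by rewrite trmx0 map_mx0. Qed.

Lemma ctr1 n : (1%:M : 'M[C]_n) ^t* = 1%:M.
Proof. by rewrite trmx1 map_mx1. Qed.

Lemma ctr_row_mx m n p (A : 'M[C]_(m, n)) (B : 'M[C]_(m, p)) :
  (row_mx A B) ^t* = col_mx (A ^t*) (B ^t*).
Proof. by rewrite tr_row_mx map_col_mx. Qed.

Lemma ctr_diag n (x : 'rV[C]_n) : (diag_mx x) ^t* = diag_mx (map_mx Num.conj x).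
Proof. by rewrite tr_diag_mx map_diag_mx. Qed.

Lemma ctr_inv n (A : 'M[C]_n) : (invmx A) ^t* = invmx (A ^t*).
Proof. by rewrite trmx_inv map_invmx. Qed.

Lemma det_ctr n (A : 'M[C]_n) : \det (A ^t*) = (\det A)^*.
Proof. by rewrite det_map_mx det_tr. Qed.

Lemma unitmx_ctr n (A : 'M[C]_n) : (A ^t* \in unitmx) = (A \in unitmx).
Proof. by rewrite map_unitmx unitmx_tr. Qed.

Lemma hermsymmxE n (A : 'M[C]_n) : (A \is hermsymmx) = (A ^t* == A).
Proof. by rewrite qualifE /= expr0 scale1r eq_sym. Qed.

Lemma unitarymx_ctrK n (A : 'M[C]_n) : A \is unitarymx -> A ^t* *m A = 1%:M.
Proof. by move=> /unitarymxP /mulmx1C. Qed.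

Lemma ctrK_unitarymx n (A : 'M[C]_n) : A ^t* *m A = 1%:M -> A \is unitarymx.
Proof. by move=> /mulmx1C ?; apply/unitarymxP. Qed.

Lemma gram_entry m n (A : 'M[C]_(m, n)) i :
  (A ^t* *m A) i i = \sum_j `|A j i| ^+ 2.
Proof. by rewrite !mxE; apply: eq_bigr => j _; rewrite !mxE normCKC. Qed.

Lemma gram_entry_ge0 m n (A : 'M[C]_(m, n)) i : 0 <= (A ^t* *m A) i i.
Proof. by rewrite gram_entry sumr_ge0 // => j _; rewrite exprn_ge0. Qed.

Lemma normsq_eq0 n (u : 'cV[C]_n) : ((u ^t* *m u) 0 0 == 0) = (u == 0).
Proof.
rewrite gram_entry psumr_eq0 => [|j _]; last exact: exprn_ge0.
apply/allP/eqP => [u0|-> j _]; last by rewrite mxE normr0 expr0n /= eqxx.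
apply/matrixP=> i j; rewrite ord1 mxE.
by have := u0 i (mem_index_enum i); rewrite expf_eq0 normr_eq0 => /eqP.
Qed.

Lemma quad_diag n (x : 'rV[C]_n) (u : 'cV[C]_n) :
  (u ^t* *m diag_mx x *m u) 0 0 = \sum_i x 0 i * `|u i 0| ^+ 2.
Proof.
rewrite mul_mx_diag mxE; apply: eq_bigr => i _; rewrite !mxE normCKC.
by rewrite mulrAC mulrC mulrCA mulrA.
Qed.

Lemma trace_gram_ge0 m n (A : 'M[C]_(m, n)) : 0 <= \tr (A ^t* *m A).
Proof. by rewrite /mxtrace sumr_ge0 // => i _; apply: gram_entry_ge0. Qed.

End Adjoint.

(** * Sorted eigenvalue decompositions of Hermitian matrices *)

Section EigenvalueDecomposition.
Variable C : numClosedFieldType.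

Lemma ctr_diag_real n (x : 'rV[C]_n) : (forall i, x 0 i \is Num.real) ->
  (diag_mx x) ^t* = diag_mx x.
Proof.
move=> xR; rewrite ctr_diag; congr diag_mx; apply/rowP => i.
by rewrite mxE; apply/CrealP.
Qed.

Lemma diag_seq_ctr_ge0 n (x : seq C) :
  (forall i, (i < n)%N -> 0 <= x`_i) -> (diag_seq n x) ^t* = diag_seq n x.
Proof. by move=> x0; apply: ctr_diag_real => i; rewrite mxE ger0_real ?x0. Qed.

Lemma det_diag_seq n (x : seq C) : \det (diag_seq n x) = \prod_(i < n) x`_i.
Proof. by rewrite det_diag; apply: eq_bigr => i _; rewrite mxE. Qed.

Lemma quad_diag_seq n (x : seq C) (u : 'cV[C]_n) :
  (u ^t* *m diag_seq n x *m u) 0 0 = \sum_(i < n) x`_i * `|u i 0| ^+ 2.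
Proof. by rewrite quad_diag; apply: eq_bigr => i _; rewrite mxE. Qed.

(** The spectral theorem gives the eigenvalues in no particular order. They are real, so [>=] is
    total on them and they can be sorted; the sorting permutation is absorbed into the unitary
    factor. *)
Lemma evd_exists n (A : 'M[C]_n) : A ^t* = A ->
  exists V (lam : seq C), is_evd A V lam.
Proof.
move=> A_herm; have Ah : A \is hermsymmx by rewrite hermsymmxE A_herm.
have dR := hermitian_spectral_diag_real Ah.
have /orthomx_spectralP A_eq := hermitian_normalmx Ah.
have PU := spectral_unitarymx A; move: A_eq dR PU.
move: (spectralmx A) (spectral_diag A) => P d A_eq dR PU.
rewrite invmx_unitary // in A_eq.
pose s := [tuple d 0 i | i < n].
have sR : {in s &, total (>=%R : rel C)}.
  move=> x y /mapP[i _ ->] /mapP[j _ ->] /=; rewrite orbC; apply: real_leVge;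
  by move/mxOverP: dR; apply.
pose s' := sort (>=%R : rel C) s.
have sz : size s' == n by rewrite size_sort size_tuple.
have s'sort : sorted (>=%R : rel C) s'.
  exact: (sort_sorted_in sR (introT allP (fun x xs => xs))).
have : perm_eq (Tuple sz) s by rewrite /= perm_sort.
case/tuple_permP => p /= s'E.
exists (P ^t* *m (perm_mx p) ^T), s'; split; rewrite ?(eqP sz) //.
  rewrite mul_unitarymx ?trmxC_unitary // trmx_unitary.
  apply/unitarymxP; rewrite tr_perm_mx map_perm_mx -perm_mxM.
  by rewrite mulgV perm_mx1.
have -> : diag_seq n s' = perm_mx p *m diag_mx d *m (perm_mx p) ^T.
  rewrite tr_perm_mx -col_permE -row_permE.
  apply/matrixP => i j; rewrite !mxE s'E (inj_eq perm_inj).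
  by rewrite (nth_map i) ?size_enum_ord // nth_ord_enum tnth_mktuple.
rewrite ctrM trmxCK trmxK map_perm_mx !mulmxA.
have pK : (perm_mx p)^T *m perm_mx p = 1%:M :> 'M[C]_n.
  by rewrite tr_perm_mx -perm_mxM mulVg perm_mx1.
by do 2 rewrite -[_ *m _^T *m perm_mx p]mulmxA pK mulmx1.
Qed.

Variables (n : nat) (A V : 'M[C]_n) (lam : seq C).
Hypothesis evdA : is_evd A V lam.

Lemma evd_diag : V ^t* *m A *m V = diag_seq n lam.
Proof.
case: evdA => _ _ /unitarymx_ctrK VV ->.
by rewrite !mulmxA VV mul1mx -mulmxA VV mulmx1.
Qed.

Lemma evd_det : \det A = \prod_(i < n) lam`_i.
Proof.
rewrite -det_diag_seq -evd_diag !det_mulmx mulrAC -det_mulmx.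
by case: evdA => _ _ /unitarymx_ctrK -> _; rewrite det1 mul1r.
Qed.

Lemma evd_trace : \tr A = \sum_(i < n) lam`_i.
Proof.
case: evdA => _ _ /unitarymx_ctrK VV ->.
rewrite mxtrace_mulC mulmxA VV mul1mx mxtrace_diag.
by apply: eq_bigr => i _; rewrite mxE.
Qed.

Lemma evd_sorted i j : (i <= j)%N -> (j < n)%N -> lam`_j <= lam`_i.
Proof.
case: evdA => sz srt _ _ ij jn.
apply: (sorted_leq_nth (leT := >=%R) _ _ 0 srt); rewrite ?inE ?sz //.
- by move=> x y z /= yx xz; apply: le_trans xz yx.
- by move=> x /=.
- by apply: leq_ltn_trans jn.
Qed.

(** Column [i] of [V] is the witness. Signs of eigenvalues are read off from the quadratic form
    through it. *)
Lemma evd_eigen i : (i < n)%N ->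
  exists2 u : 'cV[C]_n, u ^t* *m u = 1%:M & (u ^t* *m A *m u) 0 0 = lam`_i.
Proof.
move=> lt_in; pose i' := Ordinal lt_in.
have e : (V *m delta_mx i' (0 : 'I_1)) ^t* = delta_mx (0 : 'I_1) i' *m V ^t*.
  by rewrite ctrM trmx_delta map_delta_mx.
exists (V *m delta_mx i' 0).
  case: evdA => _ _ /unitarymx_ctrK VV _.
  rewrite e mulmxA -(mulmxA _ _ V) VV mulmx1 mul_delta_mx.
  by apply/matrixP => a b; rewrite !mxE !ord1.
rewrite e !mulmxA -(mulmxA _ _ A) -(mulmxA _ _ V) evd_diag -rowE -colE.
by rewrite !mxE eqxx.
Qed.

End EigenvalueDecomposition.

(** * Spectrum, determinant and trace of Gram matrices *)

Section Gram.
Variable C : numClosedFieldType.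

Lemma gram_ctr m n (N : 'M[C]_(m, n)) : (N ^t* *m N) ^t* = N ^t* *m N.
Proof. by rewrite ctrM trmxCK. Qed.

Lemma evd_gram_ge0 m n (N : 'M[C]_(m, n)) V (lam : seq C) i :
  is_evd (N ^t* *m N) V lam -> (i < n)%N -> 0 <= lam`_i.
Proof.
move=> evd /(evd_eigen evd)[u _ <-].
by rewrite mulmxA -ctrM -mulmxA gram_entry_ge0.
Qed.

Lemma det_gram_ge0 m n (N : 'M[C]_(m, n)) : 0 <= \det (N ^t* *m N).
Proof.
have [V [lam evd]] := evd_exists (gram_ctr N).
by rewrite (evd_det evd) prodr_ge0 // => i _; apply: (evd_gram_ge0 evd).
Qed.

(** The arithmetic-geometric mean inequality for the eigenvalues, which are nonnegative for a Gram
    matrix. *)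
Lemma gram_AGM m n (N : 'M[C]_(m, n)) :
  n.-root (\det (N ^t* *m N)) <= \tr (N ^t* *m N) / n%:R.
Proof.
have [V [lam evd]] := evd_exists (gram_ctr N).
rewrite (evd_det evd) (evd_trace evd).
have := @leif_rootC_AGM C 'I_n predT (fun i => lam`_i).
rewrite cardT size_enum_ord => H; apply: (H _).1 => i _.
exact: (evd_gram_ge0 evd).
Qed.

End Gram.

(** * Positive definite matrices and their inverse square roots *)

Section PositiveDefinite.
Variable C : numClosedFieldType.

Lemma posdef_gram m n (N : 'M[C]_(m, n)) :
  (forall u : 'cV[C]_n, N *m u = 0 -> u = 0) -> posdefmx (N ^t* *m N).
Proof.
move=> Ninj; split; first by rewrite hermsymmxE gram_ctr.
move=> u /eqP u0; rewrite mulmxA -ctrM -mulmxA lt0r gram_entry_ge0 andbT.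
by rewrite normsq_eq0; apply/eqP => /Ninj.
Qed.

Lemma posdef_evd_gt0 n (A V : 'M[C]_n) lam i :
  posdefmx A -> is_evd A V lam -> (i < n)%N -> 0 < lam`_i.
Proof.
move=> [_ Apd] evd /(evd_eigen evd)[u u1 <-]; apply: Apd.
apply/eqP => u0; move/matrixP/(_ 0 0)/eqP: u1.
by rewrite u0 mulmx0 !mxE eq_sym oner_eq0.
Qed.

Lemma posdef_ctr n (A : 'M[C]_n) : posdefmx A -> A ^t* = A.
Proof. by case; rewrite hermsymmxE => /eqP. Qed.

Lemma posdef_unitmx n (A : 'M[C]_n) : posdefmx A -> A \in unitmx.
Proof.
move=> Apd; have [V [lam evd]] := evd_exists (posdef_ctr Apd).
rewrite unitmxE (evd_det evd) unitfE; apply/prodf_neq0 => i _.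
by rewrite gt_eqF // (posdef_evd_gt0 Apd evd).
Qed.

(** As [invsqrtmx] is defined by choice, its specification reduces to existence: V
    diag(lam_i^(-1/2)) V^H is a solution. *)
Lemma invsqrtmxP n (A : 'M[C]_n) : posdefmx A ->
  posdefmx (invsqrtmx A) /\ invsqrtmx A *m invsqrtmx A = invmx A.
Proof.
move=> Apd; suff [X XP] : exists X, posdefmx X /\ X *m X = invmx A.
  exact: (@xgetI _ 0 [set Y | posdefmx Y /\ Y *m Y = invmx A]%classic X XP).
have [V [lam evd]] := evd_exists (posdef_ctr Apd).
have lam0 i : (i < n)%N -> 0 < lam`_i := posdef_evd_gt0 Apd evd.
pose d := \row_(i < n) sqrtC (lam`_i)^-1.
have d0 i : 0 < d 0 i by rewrite mxE sqrtC_gt0 invr_gt0 lam0.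
have [_ _ /[dup] /unitarymx_ctrK VV /unitarymxP VV' Aeq] := evd.
exists (V *m diag_mx d *m V ^t*); split; first split.
- rewrite hermsymmxE !ctrM trmxCK ctr_diag_real ?mulmxA // => i.
  exact/ger0_real/ltW.
- move=> u u0; have uV : u ^t* *m V = (V ^t* *m u) ^t* by rewrite ctrM trmxCK.
  rewrite !mulmxA uV -(mulmxA _ _ u).
  rewrite quad_diag lt0r; apply/andP; split; last first.
    by rewrite sumr_ge0 // => i _; rewrite mulr_ge0 ?exprn_ge0 // ltW.
  rewrite psumr_eq0 => [|i _]; last by rewrite mulr_ge0 ?exprn_ge0 // ltW.
  apply: contra u0 => /allP w0.
  rewrite -[u]mul1mx -VV' -mulmxA.
  suff -> : V ^t* *m u = 0 by rewrite mulmx0.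
  apply/colP => i; have := w0 i (mem_index_enum _).
  by rewrite mulf_eq0 gt_eqF //= expf_eq0 normr_eq0 [in RHS]mxE => /eqP.
- have -> : V *m diag_mx d *m V ^t* *m (V *m diag_mx d *m V ^t*) =
            V *m (diag_mx d *m diag_mx d) *m V ^t*.
    by rewrite !mulmxA -[_ *m V^t* *m V]mulmxA VV mulmx1.
  set X := (X in X = _); suff : X *m A = 1%:M.
    move=> /(congr1 (mulmx^~ (invmx A))).
    by rewrite mulmxK ?posdef_unitmx // mul1mx.
  rewrite /X Aeq !mulmxA -[_ *m V^t* *m V]mulmxA VV mulmx1.
  have -> : V *m diag_mx d *m diag_mx d *m diag_seq n lam = V.
    rewrite -2!mulmxA -[RHS]mulmx1; congr (_ *m _).
    rewrite /diag_seq !mulmx_diag -scalemx1 -diag_const_mx scale1r.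
    congr diag_mx.
    apply/rowP => i; rewrite !mxE mulrA -expr2 sqrtCK mulVf //.
    by rewrite gt_eqF ?lam0.
  exact: VV'.
Qed.

End PositiveDefinite.

(** * The lower bound *)

Section LowerBound.
Variable C : numClosedFieldType.

(* Courant-Fischer: a nonzero vector in the span of the first i + 1 eigenvectors
   of the compression that is orthogonal to the first i eigenvectors of G. *)
Lemma compression_eigenvalue_le K M (leMK : (M <= K)%N) (G V : 'M[C]_K)
    (Q : 'M[C]_(K, M)) (Y : 'M[C]_M) (lam mu : seq C) i :
  Q ^t* *m Q = 1%:M -> is_evd G V lam -> is_evd (Q ^t* *m G *m Q) Y mu ->
  (i < M)%N -> mu`_i <= lam`_i.
Proof.
move=> QQ evdG evdB lt_iM.
(* The eigenvectors of the compression, written in the eigenbasis of [G]; its columns are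
   orthonormal. *)
pose N := V ^t* *m Q *m Y.
have NN : N ^t* *m N = 1%:M.
  case: evdG evdB => _ _ /unitarymxP VV _ [_ _ /unitarymx_ctrK YY _].
  rewrite !ctrM trmxCK !mulmxA -(mulmxA _ V) VV mulmx1 -(mulmxA _ _ Q) QQ.
  by rewrite mulmx1.
(* For [c] in the kernel of [L], rows a < i say that coordinate a of N c vanishes, and rows a > i
   say that c_a = 0. Row [i] is left zero, so [L] is singular and a nonzero [c] exists. *)
pose L := \matrix_(a < M, b < M)
  if (a < i)%N then N (widen_ord leMK a) b else
  if a == i :> nat then 0 else (a == b)%:R.
have /det0P[r r0 rL] : \det L^T == 0.
  rewrite det_tr (expand_det_row _ (Ordinal lt_iM)) big1 // => j _.
  by rewrite mxE ltnn eqxx mul0r.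
pose c := r^T; pose w := N *m c.
have Lc : L *m c = 0 by rewrite -[L]trmxK -trmx_mul rL trmx0.
have c0 : c != 0 by apply: contra r0 => /eqP c0; rewrite -[r]trmxK -/c c0 trmx0.
have c_gt (a : 'I_M) : (i < a)%N -> c a 0 = 0.
  move=> ia; have /matrixP/(_ a 0) := Lc; rewrite [in RHS]mxE => <-.
  rewrite [RHS]mxE (bigD1 a) //= [L a a]mxE ltnNge ltnW //= gtn_eqF // eqxx.
  rewrite mul1r big1 ?addr0 // => b /negPf ba.
  by rewrite [L a b]mxE ltnNge ltnW //= gtn_eqF // eq_sym ba mul0r.
have w_lt (b : 'I_K) : (b < i)%N -> w b 0 = 0.
  move=> bi; have bM := ltn_trans bi lt_iM.
  have /matrixP/(_ (Ordinal bM) 0) := Lc; rewrite [in RHS]mxE => <-.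
  rewrite [LHS]mxE [RHS]mxE; apply: eq_bigr => a _; rewrite [L _ a]mxE /= bi.
  by congr (N _ a * _); apply/val_inj.
have ww : w ^t* *m w = c ^t* *m c.
  by rewrite ctrM mulmxA -(mulmxA _ _ N) NN mulmx1.
have qq : (c ^t* *m diag_seq M mu *m c) = (w ^t* *m diag_seq K lam *m w).
  rewrite -(evd_diag evdB) -(evd_diag evdG).
  case: evdG => _ _ /unitarymxP VV _.
  rewrite !ctrM trmxCK !mulmxA -(mulmxA _ V (V ^t*)) VV mulmx1.
  by rewrite -(mulmxA _ V (V ^t*)) VV mulmx1.
have t0 : 0 < (c ^t* *m c) 0 0.
  by rewrite lt0r gram_entry_ge0 normsq_eq0 c0.
rewrite -(ler_pM2r t0).
(* The common value of the two quadratic forms is at least mu_i |c|^2, as [c] lives on indices up to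
   [i], and at most lam_i |w|^2, as [w] lives on indices from [i] on. *)
apply: (@le_trans _ _ ((c ^t* *m diag_seq M mu *m c) 0 0)).
  rewrite gram_entry quad_diag_seq mulr_sumr ler_sum // => a _.
  have [ia|ai] := ltnP i a; first by rewrite c_gt // normr0 expr0n !mulr0.
  by rewrite ler_wpM2r ?exprn_ge0 // (evd_sorted evdB).
rewrite qq -ww gram_entry quad_diag_seq mulr_sumr ler_sum // => b _.
have [bi|ib] := ltnP b i; first by rewrite w_lt // normr0 expr0n !mulr0.
by rewrite ler_wpM2r ?exprn_ge0 // (evd_sorted evdG).
Qed.

(** The eigenvalue bounds can be multiplied because the eigenvalues of the compression, itself a
    Gram matrix, are nonnegative. *)
Lemma det_compression_le K M P (leMK : (M <= K)%N) (N : 'M[C]_(P, K))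
    (V : 'M[C]_K) (Q : 'M[C]_(K, M)) (lam : seq C) :
  Q ^t* *m Q = 1%:M -> is_evd (N ^t* *m N) V lam ->
  \det ((N *m Q) ^t* *m (N *m Q)) <= \prod_(i < M) lam`_i.
Proof.
move=> QQ evd; have [Y [mu evdQ]] := evd_exists (gram_ctr (N *m Q)).
rewrite (evd_det evdQ); apply: ler_prod => i _.
rewrite (evd_gram_ge0 evdQ) //=.
by apply: (compression_eigenvalue_le leMK QQ evd _ (ltn_ord i) (Y := Y));
  rewrite ctrM !mulmxA in evdQ *.
Qed.

(* The compression bound is applied to the isometry F (F^H F)^(-1/2). *)
Lemma det_precoded_le K M P (leMK : (M <= K)%N) (N : 'M[C]_(P, K))
    (V : 'M[C]_K) (F : 'M[C]_(K, M)) (lam : seq C) :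
  (forall u : 'cV[C]_M, F *m u = 0 -> u = 0) -> is_evd (N ^t* *m N) V lam ->
  \det ((N *m F) ^t* *m (N *m F)) <= \prod_(i < M) lam`_i * \det (F ^t* *m F).
Proof.
move=> Finj evd; have Spd := posdef_gram Finj.
have [Xpd XX] := invsqrtmxP Spd; set S := F ^t* *m F in Spd Xpd XX *.
move: (invsqrtmx S) Xpd XX => X Xpd XX.
have Xu := posdef_unitmx Xpd; have Su := posdef_unitmx Spd.
have XSX : X *m S *m X = 1%:M.
  apply: (can_inj (mulmxK Xu)) => /=.
  by rewrite -(mulmxA _ X X) XX mul1mx mulmxK.
have QQ : (F *m X) ^t* *m (F *m X) = 1%:M.
  by rewrite ctrM (posdef_ctr Xpd) !mulmxA -(mulmxA _ _ F).
have := det_compression_le leMK QQ evd.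
have -> : (N *m (F *m X)) ^t* *m (N *m (F *m X)) =
          X *m ((N *m F) ^t* *m (N *m F)) *m X.
  by rewrite !ctrM (posdef_ctr Xpd) !mulmxA.
have dS : 0 < \det S by rewrite lt0r det_gram_ge0 andbT -unitfE -unitmxE.
rewrite -(ler_pM2r dS); apply: le_trans.
(* From det X det S det X = 1: multiplying the bound by det S removes both factors det X. *)
have /(congr1 determinant) := XSX; rewrite !det_mulmx det1 => dX.
by rewrite -[X in X <= _]mul1r -dX mulrAC [X in X * _]mulrAC mulrAC.
Qed.

(* W splits orthogonally as W A A^+ + (W - W A A^+), and the Gram matrix of the
   first summand has determinant det(A^H A)^-1. *)
Lemma zf_trace_ge m n (n_gt0 : (0 < n)%N) (W : 'M[C]_(n, m))
    (A : 'M[C]_(m, n)) :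
  \det (W *m A) = 1 ->
  (n.-root (\det (A ^t* *m A)))^-1 <= \tr (W *m W ^t*) / n%:R.
Proof.
set U := W *m A => detU.
have Uu : U \in unitmx by rewrite unitmxE detU unitr1.
have Ainj (u : 'cV[C]_n) : A *m u = 0 -> u = 0.
  move=> Au; rewrite -[u]mul1mx -(mulVmx Uu) -!mulmxA Au !mulmx0 //.
have Epd := posdef_gram Ainj; have Eu := posdef_unitmx Epd.
set E := A ^t* *m A in Epd Eu *.
have Eadj := posdef_ctr Epd.
(* Since [U] is [W *m A], this is W A A^+. The cross terms vanish because (W - W0) A = 0. *)
pose W0 := U *m invmx E *m A ^t*.
have W0W0 : W0 *m W0 ^t* = U *m invmx E *m U ^t*.
  rewrite /W0 !ctrM trmxCK ctr_inv Eadj !mulmxA -(mulmxA _ _ A) -/E.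
  by rewrite -(mulmxA _ E) mulmxV // mulmx1.
have W1A : (W - W0) *m A = 0.
  by rewrite mulmxBl /W0 -!mulmxA -/E mulVmx // mulmx1 subrr.
have W1W0 : (W - W0) *m W0 ^t* = 0.
  by rewrite /W0 !ctrM trmxCK mulmxA W1A mul0mx.
have W0W1 : W0 *m (W - W0) ^t* = 0.
  by rewrite -[LHS]trmxCK ctrM trmxCK W1W0 ctr0.
have -> : W *m W ^t* = W0 *m W0 ^t* + (W - W0) *m (W - W0) ^t*.
  have {1 2}-> : W = W0 + (W - W0) by rewrite addrC subrK.
  move: (W - W0) W1W0 W0W1 => W1 W1W0 W0W1.
  by rewrite ctrD mulmxDl !mulmxDr W1W0 W0W1 addr0 add0r.
rewrite mxtraceD mulrDl ler_wpDr //.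
  rewrite divr_ge0 ?ler0n // -{1}[W - W0]trmxCK trace_gram_ge0 //.
have := gram_AGM (W0 ^t*); rewrite trmxCK; apply: le_trans.
rewrite W0W0 !det_mulmx det_ctr detU conjC1 mul1r mulr1 det_inv rootCV //.
exact: det_gram_ge0.
Qed.

Lemma det_strict_upperD1 n (B : 'M[C]_n) :
  (forall i j : 'I_n, (j <= i)%N -> B i j = 0) -> \det (B + 1%:M) = 1.
Proof.
move=> B_upper; rewrite -det_tr det_trig.
  by rewrite big1 // => i _; rewrite !mxE B_upper // eqxx add0r.
apply/is_trig_mxP => i j ij.
by rewrite !mxE B_upper ?(ltnW ij) // add0r -val_eqE /= gtn_eqF.
Qed.

(** Whitening with X = R^(-1/2) reduces the claim to [zf_trace_ge] for W X^(-1) and X H F. The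
    determinant of the precoded Gram matrix is then bounded by [det_precoded_le], and the root of
    det(F^H F) by tr(F^H F) / M, hence by p0 / M. *)
Lemma zf_mse_ge K M P (M_gt0 : (0 < M)%N) (leMK : (M <= K)%N) (p0 : C)
    (H : 'M[C]_(P, K)) (R : 'M[C]_P) (V : 'M[C]_K) (lam : seq C)
    (F : 'M[C]_(K, M)) (W : 'M[C]_(M, P)) :
  0 < p0 -> posdefmx R -> is_evd (H ^t* *m invmx R *m H) V lam ->
  \tr (F *m F ^t*) <= p0 -> \det (W *m H *m F) = 1 ->
  M%:R / p0 * (M.-root (\prod_(i < M) lam`_i))^-1 <=
    \tr (W *m R *m W ^t*) / M%:R.
Proof.
move=> p0_gt0 Rpd evd trF detU; have [Xpd XX] := invsqrtmxP Rpd.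
move: (invsqrtmx R) Xpd XX => X Xpd XX.
have Xu := posdef_unitmx Xpd; have Ru := posdef_unitmx Rpd.
have Xadj := posdef_ctr Xpd.
have RE : R = invmx X *m invmx X.
  have XXu : X *m X \in unitmx by rewrite unitmx_mul Xu.
  rewrite -[R]invmxK -XX; apply: (can_inj (mulmxK XXu)) => /=.
  by rewrite mulVmx // mulmxA mulmxKV // mulVmx.
have evdN : is_evd ((X *m H) ^t* *m (X *m H)) V lam.
  by rewrite ctrM Xadj !mulmxA -(mulmxA _ X X) XX.
have WRW : W *m R *m W ^t* = (W *m invmx X) *m (W *m invmx X) ^t*.
  by rewrite ctrM ctr_inv Xadj RE !mulmxA.
have detU' : \det ((W *m invmx X) *m (X *m H *m F)) = 1.
  by rewrite !mulmxA mulmxKV.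
have := zf_trace_ge M_gt0 detU'; rewrite -WRW; apply: le_trans.
have Uu : W *m H *m F \in unitmx by rewrite unitmxE detU unitr1.
have Finj (u : 'cV[C]_M) : F *m u = 0 -> u = 0.
  by move=> Fu; rewrite -[u]mul1mx -(mulVmx Uu) -!mulmxA Fu !mulmx0.
have NFinj (u : 'cV[C]_M) : X *m H *m F *m u = 0 -> u = 0.
  move=> /(congr1 (mulmx (W *m invmx X))); rewrite mulmx0 !mulmxA mulmxKV //.
  move=> Fu.
  by rewrite -[LHS](mulKmx Uu) Fu mulmx0.
have /posdef_unitmx := posdef_gram NFinj.
have /posdef_unitmx := posdef_gram Finj.
rewrite !unitmxE !unitfE => dS0 dE0.
have dS : 0 < \det (F ^t* *m F) by rewrite lt0r dS0 det_gram_ge0.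
have dE : 0 < \det ((X *m H *m F) ^t* *m (X *m H *m F)).
  by rewrite lt0r dE0 det_gram_ge0.
have le1 := det_precoded_le leMK Finj evdN.
(* Positivity is read off [le1], whose left side is positive, as is det(F^H F). *)
have lam0 : 0 < \prod_(i < M) lam`_i.
  by rewrite -(pmulr_lgt0 _ dS); apply: lt_le_trans le1.
have le2 := gram_AGM F; rewrite mxtrace_mulC in trF.
have Mp0 : 0 < M%:R / p0 by rewrite divr_gt0 ?ltr0n.
rewrite -[M%:R / p0]invf_div -invfM.
rewrite lef_pV2 ?posrE ?mulr_gt0 ?rootC_gt0 ?invr_gt0 //; last first.
  by rewrite ltr0n.
move: le1.
rewrite -(ler_rootC M_gt0) ?nnegrE ?mulr_ge0 ?(ltW dE) ?(ltW dS) ?(ltW lam0) //.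
move=> /le_trans; apply; rewrite rootCMl ?(ltW lam0) // mulrC ler_wpM2r //.
  by rewrite rootC_ge0 // ltW.
by apply: le_trans le2 _; rewrite ler_pM2r // invr_gt0 ltr0n.
Qed.

End LowerBound.

(** * Algorithm A *)

Section SchurComplement.
Variable C : numClosedFieldType.

Lemma ctr_compl_proj m k (X : 'M[C]_(m, k)) :
  (compl_proj X) ^t* = compl_proj X.
Proof.
by rewrite /compl_proj ctrB ctr1 !ctrM trmxCK ctr_inv gram_ctr mulmxA.
Qed.

Lemma compl_proj_idem m k (X : 'M[C]_(m, k)) : X ^t* *m X \in unitmx ->
  compl_proj X *m compl_proj X = compl_proj X.
Proof.
move=> Xu; rewrite {2}/compl_proj mulmxBr mulmx1.
rewrite [X in _ - X](_ : _ = 0) ?subr0 //.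
rewrite !mulmxA [compl_proj X *m X](_ : _ = 0) ?mul0mx //.
by rewrite /compl_proj mulmxBl mul1mx -(mulmxA _ _ X) mulmxKV // subrr.
Qed.

(** A Hermitian idempotent P satisfies P = P^H P. This makes the matrices A^(k) of the algorithm
    Gram matrices, with nonnegative eigenvalues. *)
Lemma compl_proj_gram m k n (X : 'M[C]_(m, k)) (Y : 'M[C]_(m, n)) :
  X ^t* *m X \in unitmx ->
  Y ^t* *m compl_proj X *m Y = (compl_proj X *m Y) ^t* *m (compl_proj X *m Y).
Proof.
move=> Xu; rewrite ctrM ctr_compl_proj !mulmxA.
by rewrite -[_ *m _ *m compl_proj X]mulmxA compl_proj_idem.
Qed.

(** Block elimination: Y^H P Y is the Schur complement of X^H X in the Gram matrix of the
    concatenation. *)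
Lemma det_gram_row_mx m k n (X : 'M[C]_(m, k)) (Y : 'M[C]_(m, n)) :
  X ^t* *m X \in unitmx ->
  \det ((row_mx X Y) ^t* *m row_mx X Y) =
  \det (X ^t* *m X) * \det (Y ^t* *m compl_proj X *m Y).
Proof.
move=> Xu; rewrite ctr_row_mx mul_col_row.
set D := X ^t* *m X in Xu *.
have -> : block_mx D (X ^t* *m Y) (Y ^t* *m X) (Y ^t* *m Y) =
  block_mx 1%:M 0 (Y ^t* *m X *m invmx D) 1%:M *m
  block_mx D (X ^t* *m Y) 0 (Y ^t* *m compl_proj X *m Y).
  rewrite mulmx_block !mul1mx !mul0mx !addr0 mulmxKV //; congr block_mx.
  rewrite /compl_proj mulmxBr mulmx1 mulmxBl !mulmxA -/D addrC subrK //.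
by rewrite det_mulmx det_lblock det_ublock !det1 !mul1r.
Qed.

(** The sizes are related by an equation because [n] is used in forms such as [k + n] or [k.+2],
    which equal [m] only propositionally. *)
Lemma det_gram_unitary m n (W : 'M[C]_(m, n)) (G : 'M[C]_m) :
  n = m -> W ^t* *m W = 1%:M ->
  \det ((G *m W) ^t* *m (G *m W)) = \det (G ^t* *m G).
Proof.
move=> e; subst n => WW; have dW : \det W * \det (W ^t*) = 1.
  by rewrite mulrC -det_mulmx WW det1.
by rewrite ctrM !mulmxA !det_mulmx mulrC !mulrA dW mul1r.
Qed.

(** Z^H u = 0 means that u^T lies in the left kernel of the conjugate of [Z], of dimension m - k
    since [Z] has rank [k]. Gram-Schmidt makes a basis of this kernel orthonormal. *)
Lemma orthonormal_complement_exists m k (Z : 'M[C]_(m, k)) :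
  Z ^t* *m Z = 1%:M ->
  exists Zp : 'M[C]_(m, m - k), orthonormal_complement Z Zp.
Proof.
move=> ZZ; pose B := kermx (map_mx Num.conj Z).
have rkB : \rank B = (m - k)%N.
  rewrite mxrank_ker mxrank_map; congr (_ - _)%N; apply/eqP.
  rewrite eqn_leq rank_leq_col /= -{1}(mxrank1 C k) -ZZ.
  exact: mxrankM_maxr.
(* The number of columns is generalised because [\rank B] equals [m - k] only propositionally. *)
suff [n [nE [Zp ZpP]]] : exists n, n = (m - k)%N /\
    exists Zp : 'M[C]_(m, n), orthonormal_complement Z Zp.
  by subst n; exists Zp.
exists (\rank B); split=> //; pose B' := schmidt (row_base B).
have B'B : (B' :=: B)%MS.
  by apply: eqmx_trans (eq_row_base B); apply/eqmx_schmidt_free/row_base_free.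
have B'U : B' \is unitarymx by apply/schmidt_unitarymx/rank_leq_col.
exists B'^T; split.
  have /unitarymxP/(congr1 trmx) := B'U.
  by rewrite trmx_mul trmx1 map_trmx.
move=> u; have -> : (Z ^t* *m u = 0) <-> (u^T <= B)%MS.
  split=> [Zu|/sub_kermxP uZ].
    apply/sub_kermxP; have := congr1 trmx Zu.
    by rewrite trmx_mul trmx0 map_trmx trmxK.
  have := congr1 trmx uZ.
  by rewrite trmx_mul trmx0 trmxK map_trmx.
rewrite -B'B; split=> [/submxP[D uD]|[c ->]].
  by exists D^T; rewrite -trmx_mul -uD trmxK.
by rewrite trmx_mul trmxK submxMl.
Qed.

End SchurComplement.

(** * Vectors supported on the two end coordinates, and the coefficients of the algorithm *)

Section Ends.
Variable C : numClosedFieldType.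

(** The size [n.+2] keeps the two ends distinct; [f] covers both inner products and diagonal
    quadratic forms. *)
Lemma ends_col_sum n (f : 'I_n.+2 -> C -> C) a b : (forall i, f i 0 = 0) ->
  \sum_i f i (ends_col n.+2 a b i 0) = f ord0 a + f ord_max b.
Proof.
move=> f0; rewrite big_ord_recl big_ord_recr /= big1 ?add0r => [|i _].
  rewrite !mxE /= mulr1n mulr0n addr0 eqxx mulr0n mulr1n add0r.
  by congr (_ + f _ _); apply/val_inj.
by rewrite mxE /= /bump /= add1n eqSS (ltn_eqF (ltn_ord i)) !mulr0n addr0.
Qed.

Lemma ends_col_dot n (a b c d : C) : (1 < n)%N ->
  ((ends_col n a b) ^t* *m ends_col n c d) 0 0 = a^* * c + b^* * d.
Proof.
case: n => [|[|n]] // _; rewrite mxE.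
rewrite (ends_col_sum (f := fun i x => (ends_col n.+2 a b) ^t* 0 i * x)).
  by rewrite !mxE /= eqxx !mulr1n !mulr0n addr0 add0r.
by move=> i; rewrite mulr0.
Qed.

Lemma ends_col_quad n (x : seq C) (a b : C) : (1 < n)%N ->
  ((ends_col n a b) ^t* *m diag_seq n x *m ends_col n a b) 0 0 =
  x`_0 * `|a| ^+ 2 + x`_n.-1 * `|b| ^+ 2.
Proof.
case: n => [|[|n]] // _; rewrite quad_diag_seq.
rewrite (ends_col_sum (f := fun i y => x`_i * `|y| ^+ 2)) //.
by move=> i; rewrite normr0 expr0n mulr0.
Qed.

Variables (g hi lo : C).
Hypotheses (le_lo_g : lo <= g) (le_g_hi : g <= hi).

Lemma coef_lo_ge0 : 0 <= coef_lo g hi lo.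
Proof.
rewrite /coef_lo; case: ifP => // _.
by rewrite sqrtC_ge0 divr_ge0 ?subr_ge0 // (le_trans le_lo_g).
Qed.

Lemma coef_hi_ge0 : 0 <= coef_hi g hi lo.
Proof.
rewrite /coef_hi; case: ifP => // _.
by rewrite sqrtC_ge0 divr_ge0 ?subr_ge0 // (le_trans le_lo_g).
Qed.

Lemma coef_norm : coef_lo g hi lo ^+ 2 + coef_hi g hi lo ^+ 2 = 1.
Proof.
rewrite /coef_lo /coef_hi; case: eqVneq => [_|ne].
  by rewrite expr1n expr0n addr0.
by rewrite !sqrtCK -mulrDl addrC addrA subrK divff // subr_eq0.
Qed.

(** The squared coefficients are the weights writing [g] as a convex combination of [hi] and [lo].
    When [hi = lo], the bounds on [g] force [g = hi], which agrees with the default pair (1, 0). *)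
Lemma coef_mean : hi * coef_lo g hi lo ^+ 2 + lo * coef_hi g hi lo ^+ 2 = g.
Proof.
rewrite /coef_lo /coef_hi; case: eqVneq => [e|ne].
  rewrite expr1n expr0n mulr0 addr0 mulr1.
  by apply/le_anti; rewrite le_g_hi andbT [X in X <= _]e.
by rewrite !sqrtCK; field; rewrite subr_eq0.
Qed.

End Ends.

(** * One step of the algorithm and its invariant *)

Section AlgorithmStep.
Variable C : numClosedFieldType.

(** Compared through n-th powers, factor by factor with constant products. *)
Lemma mean_between n (x : nat -> C) (g : C) : (0 < n)%N -> 0 <= g ->
  (forall i, (i < n)%N -> 0 <= x i) ->
  (forall i j, (i <= j)%N -> (j < n)%N -> x j <= x i) ->
  \prod_(i < n) x i = g ^+ n -> x n.-1 <= g <= x 0%N.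
Proof.
move=> n0 g0 x0 xS xg; have n1 : (n.-1 < n)%N by rewrite ltn_predL.
rewrite -(ler_pXn2r n0) ?nnegrE ?x0 // -(ler_pXn2r n0 g0) ?nnegrE ?x0 //.
have cst c : \prod_(i < n) c = c ^+ n :> C by rewrite prodr_const card_ord.
rewrite -xg -!cst.
by apply/andP; split; apply: ler_prod => i _; rewrite x0 //= xS // -ltnS prednK.
Qed.

Section Direction.
Variables (m n : nat) (N : 'M[C]_(m, n)) (V : 'M[C]_n) (lam : seq C) (g : C).
Hypotheses (n_gt1 : (1 < n)%N) (g_ge0 : 0 <= g).
Hypothesis evdN : is_evd (N ^t* *m N) V lam.
Hypothesis detN : \det (N ^t* *m N) = g ^+ n.

Let a := coef_lo g lam`_0 lam`_n.-1.
Let b := coef_hi g lam`_0 lam`_n.-1.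

Lemma mean_between_eigenvalues : lam`_n.-1 <= g <= lam`_0.
Proof.
apply: (@mean_between n (fun i => lam`_i)) => //.
- exact: ltnW.
- by move=> i; apply: (evd_gram_ge0 evdN).
- exact: (evd_sorted evdN).
- by rewrite -(evd_det evdN).
Qed.

Let a_ge0 : 0 <= a.
Proof. by have /andP[??] := mean_between_eigenvalues; apply: coef_lo_ge0. Qed.

Let b_ge0 : 0 <= b.
Proof. by have /andP[??] := mean_between_eigenvalues; apply: coef_hi_ge0. Qed.

Lemma direction_dot (c d c' d' : C) :
  ((V *m ends_col n c d) ^t* *m (V *m ends_col n c' d')) 0 0 =
  c^* * c' + d^* * d'.
Proof.
rewrite ctrM -mulmxA (mulmxA _ V).
by case: evdN => _ _ /unitarymx_ctrK -> _; rewrite mul1mx ends_col_dot.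
Qed.

Lemma direction_norm :
  (V *m ends_col n a b) ^t* *m (V *m ends_col n a b) = 1%:M.
Proof.
apply/matrixP => i j; rewrite !ord1 direction_dot !mxE eqxx.
by rewrite !(CrealP _) ?ger0_real // -!expr2 coef_norm.
Qed.

(** The pair (-b, a) is (a, b) turned by a right angle, whence the sign in the last step of the
    algorithm. *)
Lemma direction_last_norm :
  (V *m ends_col n (- b) a) ^t* *m (V *m ends_col n (- b) a) = 1%:M.
Proof.
apply/matrixP => i j; rewrite !ord1 direction_dot !mxE eqxx.
by rewrite rmorphN /= !(CrealP _) ?ger0_real // mulrNN -!expr2 addrC coef_norm.
Qed.

Lemma direction_last_ortho :
  (V *m ends_col n a b) ^t* *m (V *m ends_col n (- b) a) = 0.
Proof.
apply/matrixP => i j; rewrite !ord1 direction_dot !mxE.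
by rewrite !(CrealP _) ?ger0_real // mulrN mulrC addNr.
Qed.

(** In the eigenbasis the quadratic form only sees the extreme eigenvalues, weighted as in
    [coef_mean]. *)
Lemma direction_quad :
  (V *m ends_col n a b) ^t* *m (N ^t* *m N) *m (V *m ends_col n a b) = g%:M.
Proof.
set e := ends_col n a b; set A := N ^t* *m N.
have -> : (V *m e) ^t* *m A *m (V *m e) = e ^t* *m (V ^t* *m A *m V) *m e.
  by rewrite ctrM !mulmxA.
rewrite (evd_diag evdN); apply/matrixP => i j.
rewrite !ord1 ends_col_quad // [RHS]mxE eqxx.
rewrite !ger0_norm //.
by have /andP[??] := mean_between_eigenvalues; rewrite coef_mean.
Qed.

End Direction.

Variables (M : nat) (Gam : 'M[C]_M) (g : C) (s : nat -> 'cV[C]_M).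
Hypotheses (g_gt0 : 0 < g) (detGam : \det (Gam ^t* *m Gam) = g ^+ M).

(** The invariant after [k] columns. Its determinants are the leading minors of the Gram matrix of
    Gamma S. *)
Definition columns_ok k : Prop :=
  (cols_mx k s) ^t* *m cols_mx k s = 1%:M /\
  \det ((Gam *m cols_mx k s) ^t* *m (Gam *m cols_mx k s)) = g ^+ k.

(** Stated with [k + 1], the column count of [row_mx]. *)
Lemma cols_mxD1 k : cols_mx (k + 1) s = row_mx (cols_mx k s) (s k).
Proof.
apply/matrixP => i j; rewrite [LHS]mxE [RHS]mxE; case: splitP => l ->.
  by rewrite mxE.
by rewrite (ord1 l) addn0.
Qed.

Lemma columns_ok0 : columns_ok 0.
Proof.
split; first by apply/matrixP => -[].
by rewrite det_mx00 expr0.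
Qed.

Lemma gram_row_mx m k n (Z : 'M[C]_(m, k)) (Y : 'M[C]_(m, n)) :
  Z ^t* *m Z = 1%:M -> Z ^t* *m Y = 0 -> Y ^t* *m Y = 1%:M ->
  (row_mx Z Y) ^t* *m row_mx Z Y = 1%:M.
Proof.
move=> ZZ ZY YY; have YZ : Y ^t* *m Z = 0.
  by rewrite -[LHS]trmxCK ctrM trmxCK ZY ctr0.
by rewrite ctr_row_mx mul_col_row ZZ ZY YZ YY -scalar_mx_block.
Qed.

Section Step.
Variables (k n : nat) (Zp : 'M[C]_(M, n)).
Hypotheses (knM : (k + n)%N = M) (ok : columns_ok k).
Hypothesis Zp_compl : orthonormal_complement (cols_mx k s) Zp.
Let Z := cols_mx k s.
Let P := compl_proj (Gam *m Z).

Lemma gram_cols_unit : (Gam *m Z) ^t* *m (Gam *m Z) \in unitmx.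
Proof. by rewrite unitmxE (proj2 ok) unitrX // unitfE gt_eqF. Qed.

Lemma cols_compl_ortho : Z ^t* *m Zp = 0.
Proof.
apply/matrixP => i j; have [_ H] := Zp_compl.
have : Z ^t* *m (Zp *m delta_mx j (0 : 'I_1)) = 0.
  by apply/H; exists (delta_mx j 0).
by rewrite mulmxA -colE => /matrixP/(_ i 0); rewrite !mxE.
Qed.

Lemma deflated_gram :
  (Gam *m Zp) ^t* *m P *m (Gam *m Zp) =
  (P *m (Gam *m Zp)) ^t* *m (P *m (Gam *m Zp)).
Proof. exact: compl_proj_gram gram_cols_unit. Qed.

(** Z_k and its complement together form a unitary matrix, with total Gram determinant g^M; the
    Schur factorisation splits off g^k. *)
Lemma det_deflated : \det ((Gam *m Zp) ^t* *m P *m (Gam *m Zp)) = g ^+ n.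
Proof.
have WW := gram_row_mx (proj1 ok) cols_compl_ortho (proj1 Zp_compl).
have := det_gram_unitary Gam knM WW.
rewrite mul_mx_row det_gram_row_mx ?gram_cols_unit // (proj2 ok) detGam.
(* Only the exponent may be rewritten, since [M] also occurs in types. *)
rewrite -(congr1 (GRing.exp g) knM) exprD => /mulfI; apply.
by rewrite expf_neq0 // gt_eqF.
Qed.

(** Appending the column Zp y multiplies the Gram determinant by the 1 x 1 Schur complement y^H
    A^(k) y = g. *)
Lemma columns_ok_step (y : 'cV[C]_n) : y ^t* *m y = 1%:M ->
  y ^t* *m ((Gam *m Zp) ^t* *m P *m (Gam *m Zp)) *m y = g%:M ->
  s k = Zp *m y -> columns_ok k.+1.
Proof.
move=> yy yAy sk; rewrite -addn1 /columns_ok cols_mxD1 sk; split.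
  apply: gram_row_mx; first exact: (proj1 ok).
    by rewrite mulmxA cols_compl_ortho mul0mx.
  by rewrite ctrM mulmxA -(mulmxA _ _ Zp) (proj1 Zp_compl) mulmx1.
rewrite mul_mx_row det_gram_row_mx ?gram_cols_unit // (proj2 ok).
rewrite exprD expr1; congr (_ * _); rewrite det_mx11.
by move/matrixP/(_ 0 0): yAy; rewrite !ctrM !mulmxA [RHS]mxE eqxx mulr1n => <-.
Qed.

End Step.

End AlgorithmStep.

(** * Correctness of every output of the algorithm *)

Section AlgorithmA.
Variable C : numClosedFieldType.
Variables (M : nat) (gam : seq C).
Hypotheses (M_gt0 : (0 < M)%N) (size_gam : size gam = M).
Hypothesis gam_gt0 : forall i, (i < M)%N -> 0 < gam`_i.
Hypothesis gam_sorted : sorted >=%R gam.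

Let Gam : 'M[C]_M := diag_seq M gam.
Let g : C := M.-root (\prod_(i < M) gam`_i ^+ 2).

Lemma prod_gam_sqr_gt0 : 0 < \prod_(i < M) gam`_i ^+ 2.
Proof. by apply: prodr_gt0 => i _; rewrite exprn_gt0 ?gam_gt0. Qed.

Lemma gmean_gt0 : 0 < g.
Proof. by rewrite rootC_gt0 // prod_gam_sqr_gt0. Qed.

Lemma Gam_ctr : Gam ^t* = Gam.
Proof. by apply: diag_seq_ctr_ge0 => i iM; rewrite ltW ?gam_gt0. Qed.

Lemma Gam_sqr : Gam ^t* *m Gam = diag_seq M [seq x ^+ 2 | x <- gam].
Proof.
rewrite Gam_ctr /Gam /diag_seq mulmx_diag; congr diag_mx; apply/rowP => i.
by rewrite !mxE (nth_map 0) ?size_gam // expr2.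
Qed.

Lemma det_Gam_sqr : \det (Gam ^t* *m Gam) = g ^+ M.
Proof.
rewrite Gam_sqr det_diag_seq rootCK //; apply: eq_bigr => i _.
by rewrite (nth_map 0) // size_gam.
Qed.

(** The case k = 0: the projector is I and A^(0) = Gamma^2 is already diagonal and sorted. The size
    [n] stands for [M - 0], not convertible to [M]. *)
Lemma first_step n (s : nat -> 'cV[C]_M) : n = M ->
  [/\ orthonormal_complement (cols_mx 0 s) (pid_mx M : 'M[C]_(M, n)),
      is_evd ((Gam *m pid_mx M) ^t* *m compl_proj (Gam *m cols_mx 0 s)
                *m (Gam *m pid_mx M)) (1%:M : 'M[C]_n) [seq x ^+ 2 | x <- gam] &
      forall a b, (pid_mx M : 'M[C]_(M, n)) *m 1%:M *m ends_col n a b =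
                  ends_col M a b].
Proof.
move=> e; subst n; rewrite pid_mx_1; split.
- split=> [|u]; first by rewrite ctr1 mul1mx.
  split=> _; first by exists u; rewrite mul1mx.
  by apply/matrixP => -[].
- rewrite !mulmx1 /compl_proj [Gam *m cols_mx 0 s]thinmx0 !mul0mx subr0 mulmx1.
  rewrite Gam_sqr; split; first by rewrite size_map.
  + rewrite sorted_map; apply: (@sub_in_sorted _ (mem gam) >=%R) gam_sorted.
      have gam_nneg x : x \in gam -> x \is Num.nneg.
        by case/(nthP 0) => i; rewrite size_gam => iM <-; exact/ltW/gam_gt0.
      by move=> x y /gam_nneg x0 /gam_nneg y0 /= le_yx; exact: lerXn2r.
    exact/allP.
  + by apply/unitarymxP; rewrite ctr1 mulmx1.
  + by rewrite mul1mx ctr1 mulmx1.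
- by move=> a b; rewrite !mul1mx.
Qed.

Section Columns.
Variable s : nat -> 'cV[C]_M.
Let ok := columns_ok Gam g s.

Variables (k : nat) (Zp : 'M[C]_(M, M - k)) (V : 'M[C]_(M - k)) (lam : seq C).
Hypotheses (lt_k1M : (k.+1 < M)%N) (ok_k : ok k).
Hypothesis Zp_compl : orthonormal_complement (cols_mx k s) Zp.
Hypothesis evdA : is_evd ((Gam *m Zp) ^t* *m compl_proj (Gam *m cols_mx k s)
                          *m (Gam *m Zp)) V lam.
Let lo := coef_lo g lam`_0 lam`_(M - k).-1.
Let hi := coef_hi g lam`_0 lam`_(M - k).-1.
Hypothesis sk : s k = Zp *m V *m ends_col (M - k) lo hi.

Let knM : (k + (M - k))%N = M.
Proof. by rewrite subnKC // ltnW // ltnW. Qed.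

Let n_gt1 : (1 < M - k)%N.
Proof. by rewrite ltn_subRL addn1. Qed.

Let detA := det_deflated gmean_gt0 det_Gam_sqr knM ok_k Zp_compl.
Let gramA := deflated_gram gmean_gt0 Zp ok_k.

Lemma columns_ok_next : ok k.+1.
Proof.
(* The direction lemmas apply to Gram matrices, so A^(k) is put in that form. *)
move: detA evdA; rewrite gramA => detA' evdA'.
apply: (columns_ok_step gmean_gt0 ok_k Zp_compl
          (y := V *m ends_col (M - k) lo hi)).
- exact: (direction_norm n_gt1 (ltW gmean_gt0) evdA' detA').
- by rewrite gramA (direction_quad n_gt1 (ltW gmean_gt0) evdA' detA').
- by rewrite sk mulmxA.
Qed.

Hypothesis k2M : k.+2 = M.
Hypothesis sk1 : s k.+1 = Zp *m V *m ends_col (M - k) (- hi) lo.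

(** Only orthonormality is at stake: once all [M] columns are orthonormal, the Gram determinant is
    that of Gamma, namely g^M. The last two columns share one eigenbasis. *)
Lemma columns_ok_last : ok k.+2.
Proof.
move: detA evdA; rewrite gramA => detA' evdA'.
suff ZZ : (cols_mx k.+2 s) ^t* *m cols_mx k.+2 s = 1%:M.
  split=> //; rewrite det_gram_unitary // det_Gam_sqr.
  by rewrite (congr1 (GRing.exp g) k2M).
rewrite -[k.+2]addn1 cols_mxD1 sk1 -mulmxA; apply: gram_row_mx.
- exact: (proj1 columns_ok_next).
- rewrite -addn1 cols_mxD1 sk ctr_row_mx mul_col_mx mulmxA.
  rewrite cols_compl_ortho // mul0mx -(mulmxA Zp V) ctrM !mulmxA.
  rewrite -(mulmxA _ _ Zp) (proj1 Zp_compl) mulmx1 -mulmxA.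
  by rewrite (direction_last_ortho n_gt1 (ltW gmean_gt0) evdA' detA') col_mx0.
- rewrite ctrM mulmxA -(mulmxA _ _ Zp) (proj1 Zp_compl) mulmx1.
  exact: (direction_last_norm n_gt1 (ltW gmean_gt0) evdA' detA').
Qed.

End Columns.

Lemma algorithmA_columns (S : 'M[C]_M) : algorithmA gam S ->
  exists2 s, S = cols_mx M s & forall k, (k <= M)%N -> columns_ok Gam g s k.
Proof.
case=> s [Zp [V [lam [[Zp0 V0 lam0] s0 stepk stepM SE]]]]; exists s => //.
have [ok0 evd0 ends0] := first_step s (subn0 M).
have step k : (k.+1 < M)%N -> [/\ orthonormal_complement (cols_mx k s) (Zp k),
    is_evd ((Gam *m Zp k) ^t* *m compl_proj (Gam *m cols_mx k s)
       *m (Gam *m Zp k)) (V k) (lam k) &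
    s k = Zp k *m V k *m
      ends_col (M - k) (coef_lo g (lam k)`_0 (lam k)`_(M - k).-1)
                       (coef_hi g (lam k)`_0 (lam k)`_(M - k).-1)].
  case: k => [_|k k1M]; last by apply: stepk; rewrite /= ltn_subRL add2n.
  rewrite Zp0 V0 lam0; split=> //; rewrite s0 ends0.
  by rewrite subn0 !(nth_map 0) ?size_gam // ltn_predL.
have okk k : (k.+1 <= M)%N -> columns_ok Gam g s k.
  elim: k => [_|k IHk kM]; first exact: columns_ok0.
  have [Zk evdk sk] := step _ kM.
  exact: (columns_ok_next kM (IHk (ltnW kM)) Zk evdk sk).
move=> k; rewrite leq_eqVlt => /orP[/eqP ->|]; last exact: okk.
move: stepM; have [M2|M1 _] := ltnP 1 M.
  move=> /(_ isT); have e : (M - 2).+2 = M by rewrite -addn2 subnK.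
  have lt1 : ((M - 2).+1 < M)%N by rewrite e.
  have [Zk evdk sk] := step _ lt1.
  have -> : M.-1 = (M - 2).+1 by rewrite -[in LHS]e.
  move=> sM; rewrite -[k in columns_ok _ _ _ k]e.
  by apply: (columns_ok_last lt1 (okk _ (ltnW lt1)) Zk evdk sk e sM).
(* For M = 1 the extreme values coincide, and the default pair (1, 0) makes the output the
   identity. *)
have M1' : M = 1%N by apply/eqP; rewrite eqn_leq M1.
have S1 : cols_mx M s = 1%:M.
  apply/matrixP => i j; rewrite mxE.
  have ord0E (l : 'I_M) : l = 0%N :> nat.
    by have := ltn_ord l; rewrite [X in (_ < X)%N]M1' ltnS leqn0 => /eqP.
  rewrite ord0E s0 [RHS]mxE -val_eqE /= !ord0E mxE ord0E /coef_lo /coef_hi.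
  by rewrite (_ : M.-1 = 0%N) ?M1' // !eqxx addr0.
split; first by rewrite S1 ctr1 mulmx1.
by rewrite S1 mulmx1 det_Gam_sqr.
Qed.

End AlgorithmA.

(** * Existence of an output of the algorithm *)

Section AlgorithmAExists.
Variable C : numClosedFieldType.
Variables (M : nat) (gam : seq C).
Hypotheses (M_gt0 : (0 < M)%N) (size_gam : size gam = M).
Hypothesis gam_gt0 : forall i, (i < M)%N -> 0 < gam`_i.
Hypothesis gam_sorted : sorted >=%R gam.

Let Gam : 'M[C]_M := diag_seq M gam.
Let g : C := M.-root (\prod_(i < M) gam`_i ^+ 2).

(* The choices made at k = 0 are those prescribed by [algorithmA]. *)
Let compl k (Z : 'M[C]_(M, k)) : 'M[C]_(M, M - k) :=
  if k == 0%N then pid_mx M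
  else xget 0 [set Zp | orthonormal_complement Z Zp]%classic.

Let deflated k (Z : 'M[C]_(M, k)) : 'M[C]_(M - k) :=
  (Gam *m compl Z) ^t* *m compl_proj (Gam *m Z) *m (Gam *m compl Z).

Let evd k (Z : 'M[C]_(M, k)) : 'M[C]_(M - k) * seq C :=
  if k == 0%N then (1%:M, [seq x ^+ 2 | x <- gam])
  else xget (0, [::]) [set Vl | is_evd (deflated Z) Vl.1 Vl.2]%classic.

Let dir k (Z : 'M[C]_(M, k)) (c : C -> C -> C -> C) (c' : C -> C -> C -> C) :
    'cV[C]_M :=
  let hi := (evd Z).2`_0 in let lo := (evd Z).2`_(M - k).-1 in
  compl Z *m (evd Z).1 *m ends_col (M - k) (c g hi lo) (c' g hi lo).

Let next k (Z : 'M[C]_(M, k)) := dir Z (@coef_lo C) (@coef_hi C).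

(** Course-of-values recursion: a column depends on all earlier ones through a matrix whose type
    varies with [k], so the whole sequence built so far is carried, extended by 0. *)
Fixpoint columns_upto (nxt : forall k, 'M[C]_(M, k) -> 'cV[C]_M) k :
    nat -> 'cV[C]_M :=
  if k is k'.+1 then
    fun j => if j == k' then nxt k' (cols_mx k' (columns_upto nxt k'))
             else columns_upto nxt k' j
  else fun=> 0.

Let s0 k := columns_upto next k.+1 k.

(** The sequence [s0] follows the general rule at every index; only the last column, for M > 1, is
    replaced by the one of the final step. *)
Let s k :=
  if (1 < M)%N && (k == M.-1) then
    dir (cols_mx (M - 2) s0) (fun g hi lo => - coef_hi g hi lo) (@coef_lo C)
  else s0 k.

Lemma eq_cols_mx k (t t' : nat -> 'cV[C]_M) :
  (forall j, (j < k)%N -> t j = t' j) -> cols_mx k t = cols_mx k t'.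
Proof. by move=> tt'; apply/matrixP => i j; rewrite !mxE tt'. Qed.

Lemma columns_uptoE nxt k j : (j < k)%N ->
  columns_upto nxt k j = columns_upto nxt j.+1 j.
Proof.
elim: k => // k IHk; rewrite ltnS leq_eqVlt => /orP[/eqP -> //|jk].
by rewrite -IHk //= ltn_eqF.
Qed.

Let s0E k : s0 k = next (cols_mx k s0).
Proof.
rewrite /s0 /= eqxx; congr next; apply: eq_cols_mx => j.
exact: columns_uptoE.
Qed.

Let cols_sE k : (k < M)%N -> cols_mx k s = cols_mx k s0.
Proof.
move=> kM; apply: eq_cols_mx => j jk; rewrite /s.
case: eqP => [e|]; rewrite ?andbF //.
by move: jk; rewrite e ltnNge -ltnS prednK // kM.
Qed.

(** The invariant makes both choices succeed: orthonormality gives a complement, and the nonzero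
    Gram determinant makes A^(k) a Gram matrix, hence diagonalisable. *)
Let step_spec k : (k.+1 < M)%N -> columns_ok Gam g s0 k ->
  orthonormal_complement (cols_mx k s0) (compl (cols_mx k s0)) /\
  is_evd (deflated (cols_mx k s0))
         (evd (cols_mx k s0)).1 (evd (cols_mx k s0)).2.
Proof.
case: k => [|k] kM ok.
  rewrite /deflated /compl /evd /=.
  by case: (first_step size_gam gam_gt0 gam_sorted s0 (subn0 M)).
have Zp : orthonormal_complement (cols_mx k.+1 s0) (compl (cols_mx k.+1 s0)).
  have [Zp ZpP] := orthonormal_complement_exists (proj1 ok).
  exact: (@xgetI _ 0 [set Zp | orthonormal_complement _ Zp]%classic Zp ZpP).
split=> //.
have [V [lam VlP]] : exists V lam, is_evd (deflated (cols_mx k.+1 s0)) V lam.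
  apply: evd_exists; rewrite /deflated.
  rewrite (deflated_gram (gmean_gt0 M_gt0 gam_gt0) _ ok).
  exact: gram_ctr.
exact: (@xgetI _ (0, [::]) [set Vl | is_evd _ Vl.1 Vl.2]%classic (V, lam) VlP).
Qed.

Let s0_ok k : (k < M)%N -> columns_ok Gam g s0 k.
Proof.
elim: k => [_|k IHk kM]; first exact: columns_ok0.
have okk := IHk (ltnW kM); have [Zk evdk] := step_spec kM okk.
exact: (columns_ok_next M_gt0 size_gam gam_gt0 kM okk Zk evdk (s0E k)).
Qed.

Lemma algorithmA_exists : exists S : 'M[C]_M, algorithmA gam S.
Proof.
exists (cols_mx M s), s, (fun k => compl (cols_mx k s)),
  (fun k => (evd (cols_mx k s)).1), (fun k => (evd (cols_mx k s)).2).
split=> //.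
- have -> : s 0%N = next (cols_mx 0 s0).
    rewrite /s -s0E; case: ltnP => // M1.
    by rewrite eq_sym -leqn0 -ltnS prednK // leqNgt M1.
  rewrite /next /dir /evd /compl /=.
  have [_ _ ->] := first_step size_gam gam_gt0 gam_sorted s0 (subn0 M).
  by rewrite subn0 !(nth_map 0) ?size_gam // ltn_predL.
- move=> k /andP[k1 kM2].
  have k1M : (k.+1 < M)%N.
    have M2 : (2 < M)%N by rewrite -subn_gt0 (leq_trans k1).
    by move: kM2; rewrite leq_subRL ?add2n // ltnW.
  have kM := ltnW k1M.
  rewrite !cols_sE // ?ltnW //.
  have [Zk evdk] := step_spec k1M (s0_ok (ltnW k1M)); split=> //.
  rewrite /s ifF ?s0E //; apply/negP => /andP[_ /eqP kE].
  by move: k1M; rewrite kE prednK // ltnn.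
- move=> M2 /=; rewrite cols_sE; last by rewrite ltn_subrL.
  by rewrite /s M2 eqxx.
Qed.

End AlgorithmAExists.

(** * QR decomposition *)

Section QR.
Variable C : numClosedFieldType.

(** [schmidt] orthonormalises rows, so it is applied to A^T. *)
Lemma qr_exists n (A : 'M[C]_n) : exists Q U, is_qr A Q U.
Proof.
pose B := schmidt A^T; have BU : B \is unitarymx by exact: schmidt_unitarymx.
have BB := unitarymx_ctrK BU.
have TE i j : (A^T *m B ^t*) i j = dotmx (row i A^T) (row j B).
  by rewrite dotmxE !mxE; apply: eq_bigr => k _; rewrite !mxE.
exists B^T, (A^T *m B ^t*)^T; split.
- by rewrite trmx_unitary.
- move=> i j ji; rewrite mxE TE dotmxE.
  suff -> : row j A^T *m (row i B) ^t* = 0 by rewrite mxE.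
  (* Row [j] of A^T lies in the span of the Schmidt rows of index at most j < i, all orthogonal to
     row [i]. *)
  apply/sub_kermxP/(submx_trans (row_schmidt_sub _ _)).
  apply/sumsmx_subP => k kj; rewrite genmxE; apply/sub_kermxP.
  apply/matrixP => a b; rewrite !ord1 -dotmxE (row_unitarymxP BU) mxE.
  by rewrite -val_eqE ltn_eqF // (leq_ltn_trans kj).
- by move=> i; rewrite mxE TE form1_row_schmidt.
- by rewrite -trmx_mul -mulmxA BB mulmx1 trmxK.
Qed.

Section LeadingMinors.
Variables (n : nat) (U : 'M[C]_n).
Hypothesis U_trig : forall i j : 'I_n, (j < i)%N -> U i j = 0.
Variables (k : nat) (lekn : (k <= n)%N).
Let w := widen_ord lekn.

(** A triangular [U] preserves the span of the first [k] coordinates, so the determinant is that of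
    the leading block times its conjugate. *)
Lemma det_gram_leading :
  \det ((U *m pid_mx k) ^t* *m (U *m pid_mx k : 'M[C]_(n, k))) =
  \prod_(i < k) `|U (w i) (w i)| ^+ 2.
Proof.
pose Uk := \matrix_(i < k, j < k) U (w i) (w j).
have UE : U *m pid_mx k = (pid_mx k : 'M[C]_(n, k)) *m Uk.
  apply/matrixP => i j; rewrite !mxE (bigD1 (w j)) //= big1 ?addr0; last first.
    move=> l lj; rewrite mxE (_ : _ == _ = false) ?mulr0 //.
    by apply: contraNF lj => /eqP lj; apply/eqP/val_inj.
  rewrite mxE eqxx /= ltn_ord mulr1.
  have [ik|ki] := ltnP i k.
    rewrite (bigD1 (Ordinal ik)) //= big1 ?addr0; last first.
      move=> l li; rewrite mxE (_ : _ == _ = false) ?mul0r //.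
      by rewrite eq_sym; apply: negbTE.
    by rewrite !mxE eqxx /= ik mul1r; congr (U _ _); apply: val_inj.
  rewrite big1 => [|l _]; first by apply: U_trig; apply: leq_trans ki => /=.
  by rewrite mxE ltnNge ki andbF mul0r.
have EE : (pid_mx k : 'M[C]_(n, k)) ^t* *m pid_mx k = 1%:M.
  by rewrite tr_pid_mx map_pid_mx mul_pid_mx minnn (minn_idPr lekn) pid_mx_1.
rewrite UE ctrM !mulmxA -(mulmxA _ _ (pid_mx k)) EE mulmx1 det_mulmx det_ctr.
have -> : \det Uk = \prod_(i < k) U (w i) (w i).
  rewrite -det_tr det_trig; first by apply: eq_bigr => i _; rewrite !mxE.
  by apply/is_trig_mxP => i j ij; rewrite !mxE U_trig.
rewrite rmorph_prod -big_split /=; apply: eq_bigr => i _.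
by rewrite normCKC.
Qed.

End LeadingMinors.

(** [Q] drops out of Gram matrices, so the minors of orders i and i + 1 are g^i and g^(i+1), and
    their quotient is |U_ii|^2. The sign normalisation selects the root. *)
Lemma qr_diag M (Gam : 'M[C]_M) (g : C) (s : nat -> 'cV[C]_M) (Q U : 'M[C]_M) :
  0 < g -> (forall k, (k <= M)%N -> columns_ok Gam g s k) ->
  is_qr (Gam *m cols_mx M s) Q U -> forall i, U i i = sqrtC g.
Proof.
move=> g0 ok [QU U_trig U_ge0 AE] i.
have minor k (lekM : (k <= M)%N) :
    \prod_(j < k) `|U (widen_ord lekM j) (widen_ord lekM j)| ^+ 2 = g ^+ k.
  rewrite -(det_gram_leading U_trig) -(proj2 (ok _ lekM)).
  have -> : cols_mx k s = cols_mx M s *m pid_mx k.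
    apply/matrixP => a j.
    rewrite !mxE (bigD1 (widen_ord lekM j)) //= big1 ?addr0.
      by rewrite !mxE eqxx /= ltn_ord mulr1.
    move=> l lj; rewrite !mxE (_ : _ == _ = false) ?mulr0 //.
    by apply: contraNF lj => /eqP lj; apply/eqP/val_inj.
  have -> : Gam *m (cols_mx M s *m pid_mx k) =
            Q *m (U *m pid_mx k) :> 'M[C]_(M, k).
    by rewrite mulmxA AE -mulmxA.
  rewrite (ctrM Q) -[in RHS]mulmxA (mulmxA (Q ^t*)).
  by rewrite (unitarymx_ctrK QU) mul1mx.
have := minor _ (ltn_ord i); rewrite big_ord_recr /= (exprSr g).
rewrite [X in X * _ = _](_ : _ = g ^+ i); last first.
  rewrite -(minor _ (ltnW (ltn_ord i))); apply: eq_bigr => j _.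
  by congr (`|U _ _| ^+ 2); apply: val_inj.
have q0 : g ^+ i != 0 by rewrite expf_neq0 // gt_eqF.
move=> /(mulfI q0); rewrite (_ : widen_ord _ _ = i); last exact: val_inj.
by rewrite ger0_norm // => <-; rewrite sqrCK.
Qed.

End QR.

(** * Second-order statistics *)

Section Expectation.
Context d (T : measurableType d) (R : realType) (Pr : probability T R).

(** The condition under which [cexpectation], taken on real and imaginary parts, is linear. *)
Definition cintegrable (Z : T -> R[i]) : Prop :=
  (fun t => complex.Re (Z t)) \in Lfun Pr 1 /\
  (fun t => complex.Im (Z t)) \in Lfun Pr 1.

Lemma cexpectation_add (X Y : T -> R[i]) : cintegrable X -> cintegrable Y ->
  cintegrable (fun t => X t + Y t) /\
  cexpectation Pr (fun t => X t + Y t) = cexpectation Pr X + cexpectation Pr Y.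
Proof.
move=> [rX iX] [rY iY].
have rE : (fun t => complex.Re (X t + Y t)) =
    (fun t => complex.Re (X t)) \+ (fun t => complex.Re (Y t)).
  by apply/funext => t /=; case: (X t); case: (Y t).
have iE : (fun t => complex.Im (X t + Y t)) =
    (fun t => complex.Im (X t)) \+ (fun t => complex.Im (Y t)).
  by apply/funext => t /=; case: (X t); case: (Y t).
split; first by split; rewrite ?rE ?iE; apply: rpredD.
rewrite /cexpectation rE iE !expectationD // !fineD ?expectation_fin_num //.
Qed.

Lemma cexpectation_scale (c : R[i]) (X : T -> R[i]) : cintegrable X ->
  cintegrable (fun t => c * X t) /\
  cexpectation Pr (fun t => c * X t) = c * cexpectation Pr X.
Proof.
case: c => a b [rX iX].
have sc (k : R) (f : T -> R) : f \in Lfun Pr 1 -> (k \o* f) \in Lfun Pr 1.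
  by move=> ?; apply: Lfun_scale.
have rE : (fun t => complex.Re (Complex a b * X t)) =
    (a \o* (fun t => complex.Re (X t))) \- (b \o* (fun t => complex.Im (X t))).
  by apply/funext => t /=; case: (X t) => u w /=; rewrite (mulrC u) (mulrC w).
have iE : (fun t => complex.Im (Complex a b * X t)) =
    (a \o* (fun t => complex.Im (X t))) \+ (b \o* (fun t => complex.Re (X t))).
  by apply/funext => t /=; case: (X t) => u w /=; rewrite (mulrC u) (mulrC w).
split.
  by split; rewrite ?rE ?iE; [apply: rpredB|apply: rpredD]; apply: sc.
rewrite /cexpectation rE iE expectationB ?expectationD ?sc // !expectationZl //.
by rewrite fineB ?fineD ?fineM ?fin_numM ?expectation_fin_num.
Qed.

Lemma cexpectation_sum (I : Type) (r : seq I) (X : I -> T -> R[i]) :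
  (forall i, cintegrable (X i)) ->
  cintegrable (fun t => \sum_(i <- r) X i t) /\
  cexpectation Pr (fun t => \sum_(i <- r) X i t) =
  \sum_(i <- r) cexpectation Pr (X i).
Proof.
move=> intX; elim: r => [|j r [IHi IHe]].
  have -> : (fun t => \sum_(i <- [::]) X i t) = (fun=> 0).
    by apply/funext => t; rewrite big_nil.
  rewrite big_nil; split.
    by split; exact: (Lfun_cst Pr 0 1).
  by rewrite /cexpectation /= (expectation_cst Pr 0).
have -> : (fun t => \sum_(i <- j :: r) X i t) =
          (fun t => X j t + \sum_(i <- r) X i t).
  by apply/funext => t; rewrite big_cons.
by rewrite big_cons -IHe; apply: cexpectation_add.
Qed.

(** Each real product of two square-integrable parts is integrable. *)
Lemma cintegrable_mul_conj (X Y : T -> R[i]) :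
  (fun t => complex.Re (X t)) \in Lfun Pr 2%:E ->
  (fun t => complex.Im (X t)) \in Lfun Pr 2%:E ->
  (fun t => complex.Re (Y t)) \in Lfun Pr 2%:E ->
  (fun t => complex.Im (Y t)) \in Lfun Pr 2%:E ->
  cintegrable (fun t => X t * (Y t)^*).
Proof.
move=> rX iX rY iY; split.
  have -> : (fun t => complex.Re (X t * (Y t)^*)) =
    ((fun t => complex.Re (X t)) \* (fun t => complex.Re (Y t))) \+
    ((fun t => complex.Im (X t)) \* (fun t => complex.Im (Y t))).
    apply/funext => t /=.
    by case: (X t) => a b; case: (Y t) => u w /=; rewrite mulrN opprK.
  by apply: rpredD; apply: Lfun2_mul_Lfun1.
have -> : (fun t => complex.Im (X t * (Y t)^*)) =
    ((fun t => complex.Im (X t)) \* (fun t => complex.Re (Y t))) \-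
    ((fun t => complex.Re (X t)) \* (fun t => complex.Im (Y t))).
  apply/funext => t /=.
  by case: (X t) => a b; case: (Y t) => u w /=; rewrite mulrN addrC.
by apply: rpredB; apply: Lfun2_mul_Lfun1.
Qed.

Lemma corrmx_mulmx n m (W : 'M[R[i]]_(m, n)) (v : T -> 'cV[R[i]]_n) :
  L2_cvector Pr v ->
  corrmx Pr (fun t => W *m v t) (fun t => W *m v t) =
  W *m corrmx Pr v v *m W ^t*.
Proof.
move=> v2; apply/matrixP => i j; rewrite mxE.
pose X p q t := v t p 0 * (v t q 0)^*.
have X_int p q : cintegrable (X p q).
  by have [? ?] := v2 p; have [? ?] := v2 q; exact: cintegrable_mul_conj.
have -> : (fun t => (W *m v t *m (W *m v t) ^t*) i j) =
    (fun t => \sum_q \sum_p (W i p * (W j q)^*) * X p q t).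
  apply/funext => t; rewrite ctrM !mulmxA mxE; apply: eq_bigr => q _.
  rewrite -mulmxA mxE mulr_suml; apply: eq_bigr => p _.
  by rewrite !mxE big_ord1 !mxE /X; ring.
have int1 q p : cintegrable (fun t => (W i p * (W j q)^*) * X p q t).
  by case: (cexpectation_scale (W i p * (W j q)^*) (X_int p q)).
have int2 q : cintegrable (fun t => \sum_p (W i p * (W j q)^*) * X p q t).
  by case: (cexpectation_sum (index_enum _) (int1 q)).
have [_ ->] := cexpectation_sum (index_enum _) int2.
rewrite mxE; apply: eq_bigr => q _.
have [_ ->] := cexpectation_sum (index_enum _) (int1 q).
rewrite mxE mulr_suml; apply: eq_bigr => p _.
have [_ ->] := cexpectation_scale (W i p * (W j q)^*) (X_int p q).
rewrite mulrAC !mxE; congr (_ * _ * _); congr cexpectation.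
by apply/funext => t; rewrite !mxE big_ord1 !mxE.
Qed.

Lemma arith_mse_zf M K P (s : T -> 'cV[R[i]]_M) (v : T -> 'cV[R[i]]_P)
    (H : 'M[R[i]]_(P, K)) (F : 'M[R[i]]_(K, M)) (B : 'M[R[i]]_M)
    (W : 'M[R[i]]_(M, P)) :
  L2_cvector Pr v -> W *m H *m F = B + 1%:M ->
  arith_mse Pr s v H F B W = \tr (W *m corrmx Pr v v *m W ^t*) / M%:R.
Proof.
move=> v2 zf; rewrite -(corrmx_mulmx W v2) /arith_mse.
suff -> : decision_error s v H F B W = (fun t => W *m v t) by [].
apply/funext => t; rewrite /decision_error zf addrK subrr mul0mx.
exact: add0r.
Qed.

End Expectation.

(** * The optimal transceiver *)

Section Optimum.
Variable C : numClosedFieldType.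

(** Existence is shown by (A^H A)^(-1) A^H; the identities are then derived from the Penrose
    equations of the chosen matrix. *)
Lemma mp_pinvmxP m n (A : 'M[C]_(m, n)) : A ^t* *m A \in unitmx ->
  mp_pinvmx A *m A = 1%:M /\
  mp_pinvmx A *m (mp_pinvmx A) ^t* = invmx (A ^t* *m A).
Proof.
move=> Eu; set E := A ^t* *m A in Eu *.
have [AXA XAX AXh _] : penrose A (mp_pinvmx A).
  suff [X XP] : exists X, penrose A X.
    exact: (@xgetI _ 0 [set X | penrose A X]%classic X XP).
  have XA : invmx E *m A ^t* *m A = 1%:M by rewrite -mulmxA mulVmx.
  exists (invmx E *m A ^t*); split.
  - by rewrite -mulmxA XA mulmx1.
  - by rewrite XA mul1mx.
  - by rewrite !ctrM trmxCK ctr_inv gram_ctr mulmxA.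
  - by rewrite XA ctr1.
move: (mp_pinvmx A) AXA XAX AXh => X AXA XAX AXh.
have XA : X *m A = 1%:M.
  rewrite -mulmxA in AXA; rewrite -[LHS](mulKmx Eu).
  by rewrite -[X in _ *m X]mulmxA AXA mulVmx.
(* Here X X^H A^H = X (A X)^H = X A X = X, so X X^H A^H A = X A = 1. *)
split=> //; have {}XAX : X *m X ^t* *m A ^t* = X.
  by rewrite -mulmxA -ctrM AXh mulmxA.
by apply: (can_inj (mulmxK Eu)) => /=; rewrite mulVmx // mulmxA XAX.
Qed.

(** Column j of N V has squared norm lam_j. If lam_i = 0, all columns from [i] on vanish and [N] has
    rank at most [i]. *)
Lemma evd_gram_gt0 P K (N : 'M[C]_(P, K)) V lam M i : (M <= \rank N)%N ->
  is_evd (N ^t* *m N) V lam -> (i < M)%N -> 0 < lam`_i.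
Proof.
move=> leMr evd iM; have lt_ir : (i < \rank N)%N := leq_trans iM leMr.
have lt_iK : (i < K)%N := leq_trans lt_ir (rank_leq_col N).
rewrite lt0r (evd_gram_ge0 evd lt_iK) andbT; apply: contraTneq lt_ir => lam_i0.
pose B := N *m V.
have BB : B ^t* *m B = diag_seq K lam.
  by rewrite -(evd_diag evd) ctrM !mulmxA.
have B0 (j : 'I_K) : (i <= j)%N -> col j B = 0.
  move=> ij; apply/eqP; rewrite -normsq_eq0.
  have -> : ((col j B) ^t* *m col j B) 0 0 = (B ^t* *m B) j j.
    by rewrite !gram_entry; apply: eq_bigr => l _; rewrite mxE.
  rewrite BB !mxE eqxx mulr1n.
  have := evd_sorted evd ij (ltn_ord j); rewrite lam_i0 => le_j0.
  by apply/eqP/le_anti; rewrite (evd_gram_ge0 evd) // andbT.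
have BE : B = B *m pid_mx i.
  apply/matrixP => a j; rewrite [RHS]mxE (bigD1 j) //= big1 ?addr0; last first.
    by move=> l lj; rewrite [pid_mx _ _ _]mxE val_eqE (negPf lj) mulr0.
  rewrite [pid_mx _ _ _]mxE eqxx /=.
  have [ji|ij] := ltnP j i; first by rewrite mulr1.
  by rewrite mulr0; have /matrixP/(_ a 0) := B0 j ij; rewrite [LHS]mxE [RHS]mxE.
have -> : N = B *m V ^t*.
  by case: evd => _ _ /unitarymxP VV _; rewrite -mulmxA VV mulmx1.
rewrite -leqNgt; apply: leq_trans (mxrankM_maxl _ _) _.
rewrite BE; apply: leq_trans (mxrankM_maxr _ _) _.
by rewrite rank_pid_mx // ltnW.
Qed.

Lemma evd_leading K M (leMK : (M <= K)%N) (G V : 'M[C]_K) lam :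
  is_evd G V lam ->
  let VM : 'M[C]_(K, M) := \matrix_(i < K, j < M) V i (widen_ord leMK j) in
  VM ^t* *m VM = 1%:M /\ VM ^t* *m G *m VM = diag_seq M lam.
Proof.
move=> evd VM; have VME : VM = V *m pid_mx M.
  apply/matrixP => i j; rewrite !mxE (bigD1 (widen_ord leMK j)) //= big1 ?addr0.
    by rewrite mxE eqxx /= ltn_ord mulr1.
  move=> l lj; rewrite mxE (_ : _ == _ = false) ?mulr0 //.
  by apply: contraNF lj => /eqP lj; apply/eqP/val_inj.
split.
  rewrite VME ctrM mulmxA -(mulmxA _ _ V).
  case: evd => _ _ /unitarymx_ctrK -> _.
  rewrite mulmx1 tr_pid_mx map_pid_mx mul_pid_mx minnn (minn_idPr leMK).
  exact: pid_mx_1.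
have -> : VM ^t* *m G *m VM = (pid_mx M) ^t* *m (V ^t* *m G *m V) *m pid_mx M.
  by rewrite VME ctrM !mulmxA.
rewrite (evd_diag evd) tr_pid_mx map_pid_mx /diag_seq mul_mx_diag.
apply/matrixP => i j; rewrite !mxE (bigD1 (widen_ord leMK j)) //= big1 ?addr0.
  rewrite !mxE eqxx /= !ltn_ord andbT mulr1 mulrb -val_eqE /=.
  by case: eqP => [->|_]; rewrite ?mul1r ?mul0r.
move=> l lj; rewrite !mxE [(l == j :> nat)](_ : _ = false) ?mulr0 //.
by apply: contraNF lj => /eqP lj; apply/eqP/val_inj.
Qed.

(** * The proposed transceiver attains the bound *)

Section Attainment.
Variables (M K P : nat) (M_gt0 : (0 < M)%N) (leMK : (M <= K)%N).
Variables (p0 : C) (p0_gt0 : 0 < p0).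
Variables (H : 'M[C]_(P, K)) (R : 'M[C]_P) (V : 'M[C]_K) (lam : seq C).
Hypotheses (rankH : (M <= \rank H)%N) (Rpd : posdefmx R).
Hypothesis evd : is_evd (H ^t* *m invmx R *m H) V lam.

Let X := invsqrtmx R.
Let N := X *m H.
Let prodlam := \prod_(i < M) lam`_i.
Let gam := [seq sqrtC x | x <- take M lam].
Let Gam : 'M[C]_M := diag_seq M gam.

Lemma channel_gram : H ^t* *m invmx R *m H = N ^t* *m N.
Proof.
have [Xpd XX] := invsqrtmxP Rpd.
by rewrite -XX ctrM (posdef_ctr Xpd) !mulmxA.
Qed.

Lemma channel_eigenvalue_gt0 i : (i < M)%N -> 0 < lam`_i.
Proof.
have [/posdef_unitmx Xu _] := invsqrtmxP Rpd.
move: evd; rewrite channel_gram => evdN; apply: (evd_gram_gt0 _ evdN).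
by rewrite (eqmxMfull _ _) // row_full_unit.
Qed.

Lemma size_channel_gam : size gam = M.
Proof. by case: evd => szl _ _ _; rewrite size_map size_takel ?szl. Qed.

Lemma channel_gamE i : (i < M)%N -> gam`_i = sqrtC lam`_i.
Proof.
move=> iM; rewrite (nth_map 0) ?nth_take // size_takel //.
by case: evd => ->.
Qed.

Lemma channel_gam_gt0 i : (i < M)%N -> 0 < gam`_i.
Proof.
by move=> iM; rewrite channel_gamE // sqrtC_gt0 channel_eigenvalue_gt0.
Qed.

Lemma channel_gam_sorted : sorted >=%R gam.
Proof.
apply/(sortedP 0) => i; rewrite size_channel_gam => iM.
rewrite !channel_gamE ?(ltnW iM) //= ler_sqrtC ?nnegrE.
- by rewrite (evd_sorted evd) // (leq_trans iM).
- by rewrite ltW // channel_eigenvalue_gt0.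
- by rewrite ltW // channel_eigenvalue_gt0 // ltnW.
Qed.

Lemma prod_gam_sqr : \prod_(i < M) gam`_i ^+ 2 = prodlam.
Proof. by apply: eq_bigr => i _; rewrite channel_gamE // sqrtCK. Qed.

Lemma prodlam_gt0 : 0 < prodlam.
Proof. by apply: prodr_gt0 => i _; apply: channel_eigenvalue_gt0. Qed.

Lemma algorithmA_qr_exists :
  exists Psi Q Ubar : 'M[C]_M, algorithmA gam Psi /\ is_qr (Gam *m Psi) Q Ubar.
Proof.
have [Psi PsiP] := algorithmA_exists M_gt0 size_channel_gam channel_gam_gt0
  channel_gam_sorted.
by have [Q [U QU]] := qr_exists (Gam *m Psi); exists Psi, Q, U.
Qed.

Variables Psi Q Ubar : 'M[C]_M.
Hypotheses (PsiA : algorithmA gam Psi) (QR : is_qr (Gam *m Psi) Q Ubar).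

Let VM : 'M[C]_(K, M) := \matrix_(i < K, j < M) V i (widen_ord leMK j).
Let F : 'M[C]_(K, M) := sqrtC (p0 / M%:R) *: (VM *m Psi).
Let c := ((2 * M).-root prodlam)^-1.
Let U : 'M[C]_M := c *: Ubar.
Let B : 'M[C]_M := U - 1%:M.
Let W : 'M[C]_(M, P) := (B + 1%:M) *m mp_pinvmx (X *m H *m F) *m X.

Lemma Psi_columns : exists2 s, Psi = cols_mx M s &
  forall k, (k <= M)%N -> columns_ok Gam (M.-root prodlam) s k.
Proof.
have := algorithmA_columns M_gt0 size_channel_gam channel_gam_gt0
  channel_gam_sorted PsiA.
by rewrite prod_gam_sqr.
Qed.

Lemma Psi_unitary : Psi \is unitarymx.
Proof.
have [s -> /(_ M (leqnn M))[ZZ _]] := Psi_columns; exact: ctrK_unitarymx.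
Qed.

Let r_gt0 : 0 < M.-root prodlam.
Proof. by rewrite rootC_gt0 // prodlam_gt0. Qed.

(** Matches the scaling of [Ubar] with its diagonal as given by [qr_diag]. *)
Lemma root_double : (2 * M).-root prodlam = sqrtC (M.-root prodlam).
Proof.
have l0 := ltW prodlam_gt0.
rewrite -[prodlam in LHS](rootCK M_gt0) -{1}[M.-root prodlam]sqrtCK -exprM.
by rewrite exprCK ?muln_gt0 ?sqrtC_ge0 ?ltW.
Qed.

Lemma U_upper_unit :
  (forall i j : 'I_M, (j < i)%N -> U i j = 0) /\ (forall i : 'I_M, U i i = 1).
Proof.
split=> [i j ji|i]; rewrite mxE; first by case: QR => _ -> //; rewrite mulr0.
have [s PsiE ok] := Psi_columns; move: QR; rewrite PsiE => QR'.
rewrite (qr_diag r_gt0 ok QR') /c root_double mulVf //.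
by rewrite gt_eqF // sqrtC_gt0.
Qed.

Let E := (X *m H *m F) ^t* *m (X *m H *m F).

(** [VM] compresses the whitened channel Gram matrix to Gamma^2, and [Q] cancels in the Gram matrix
    of Gamma Psi = Q Ubar. *)
Lemma precoded_gram : E = (p0 / M%:R) *: (Ubar ^t* *m Ubar).
Proof.
have a0 : 0 <= p0 / M%:R by rewrite divr_ge0 ?ler0n // ltW.
have -> : E = (p0 / M%:R) *: (Psi ^t* *m (VM ^t* *m (N ^t* *m N) *m VM) *m Psi).
  rewrite /E /F -scalemxAr ctrZ -scalemxAl -scalemxAr scalerA -/N.
  rewrite (CrealP _) ?ger0_real ?sqrtC_ge0 // -expr2 sqrtCK.
  by rewrite !ctrM !mulmxA.
move: evd; rewrite channel_gram => evdN.
rewrite (proj2 (evd_leading leMK evdN)); congr (_ *: _).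
have -> : diag_seq M lam = Gam ^t* *m Gam.
  rewrite (Gam_sqr size_channel_gam channel_gam_gt0) /diag_seq; congr diag_mx.
  apply/rowP => i; rewrite !mxE (nth_map 0) ?size_channel_gam //.
  by rewrite channel_gamE // sqrtCK.
have -> : Psi ^t* *m (Gam ^t* *m Gam) *m Psi = (Gam *m Psi) ^t* *m (Gam *m Psi).
  by rewrite ctrM !mulmxA.
case: QR => /unitarymx_ctrK QQ _ _ ->.
by rewrite ctrM mulmxA -(mulmxA _ _ Q) QQ mulmx1.
Qed.

Let Ubar_unit : Ubar \in unitmx.
Proof.
have [s PsiE ok] := Psi_columns; have := proj2 (ok M (leqnn M)); rewrite -PsiE.
case: QR => /unitarymx_unit Qu _ _ ->; rewrite ctrM !det_mulmx => e.
have : M.-root prodlam ^+ M != 0 by rewrite expf_neq0 // gt_eqF.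
by rewrite -e !mulf_eq0 !negb_or unitmxE unitfE => /andP[_ /andP[]].
Qed.

Let p0M_neq0 : p0 / M%:R != 0.
Proof. by rewrite mulf_neq0 ?invr_eq0 ?pnatr_eq0 ?gt_eqF // -lt0n. Qed.

Let E_unit : E \in unitmx.
Proof.
by rewrite precoded_gram unitmxZ ?unitfE // unitmx_mul unitmx_ctr Ubar_unit.
Qed.

(** The power bound is met with equality, VM Psi having [M] orthonormal columns; zero forcing is A^+
    A = I for A = X H F. *)
Lemma optimal_zf_bdfd : zf_bdfd H p0 F B W.
Proof.
have [U_trig U1] := U_upper_unit.
have [VV _] := evd_leading leMK evd.
split.
- move=> i j; rewrite leq_eqVlt => /orP[/eqP/val_inj ->|ji].
    by rewrite mxE U1 !mxE eqxx subrr.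
  by rewrite mxE U_trig // !mxE -val_eqE gtn_eqF // subr0.
- rewrite mxtrace_mulC /F ctrZ -scalemxAl -scalemxAr scalerA mxtraceZ.
  rewrite ctrM mulmxA -(mulmxA _ _ VM) VV mulmx1 unitarymx_ctrK ?Psi_unitary //.
  rewrite mxtrace1 (CrealP _); last first.
    by rewrite ger0_real ?sqrtC_ge0 ?divr_ge0 ?ler0n ?(ltW p0_gt0).
  by rewrite -expr2 sqrtCK divfK // pnatr_eq0 -lt0n.
- rewrite /W -!mulmxA (mulmxA X) (mulmxA _ (X *m H)).
  rewrite [X in _ *m X](_ : _ = 1%:M) ?mulmx1 //.
  by have [<- _] := mp_pinvmxP E_unit; rewrite !mulmxA.
Qed.

(** The noise is whitened, X R X^H = I, so R_ee = U E^(-1) U^H; with U = c Ubar this is c^2 M / p0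
    times the identity. *)
Lemma optimal_mse :
  \tr (W *m R *m W ^t*) / M%:R = M%:R / p0 * (M.-root prodlam)^-1.
Proof.
have [Xpd XX] := invsqrtmxP Rpd; have Xu := posdef_unitmx Xpd.
have XRX : X *m R *m X ^t* = 1%:M.
  rewrite (posdef_ctr Xpd); apply: (can_inj (mulmxK Xu)) => /=.
  rewrite -(mulmxA _ X X) -/X XX mul1mx -mulmxA mulmxV ?mulmx1 //.
  exact: posdef_unitmx.
have [_ YY] := mp_pinvmxP E_unit; set Y := mp_pinvmx _ in YY.
have -> : W *m R *m W ^t* = U *m (Y *m (X *m R *m X ^t*) *m Y ^t*) *m U ^t*.
  by rewrite /W /B subrK !ctrM !mulmxA.
rewrite XRX mulmx1 YY -/E precoded_gram invmxZ; last first.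
  by rewrite unitmxZ ?unitfE // unitmx_mul unitmx_ctr Ubar_unit.
have GG : Ubar *m invmx (Ubar ^t* *m Ubar) *m Ubar ^t* = 1%:M.
  apply: (can_inj (mulmxK Ubar_unit)) => /=.
  rewrite -(mulmxA _ (Ubar ^t*)) mulmxKV ?mul1mx //.
  by rewrite unitmx_mul unitmx_ctr Ubar_unit.
rewrite /U ctrZ -scalemxAl -!scalemxAr -!scalemxAl GG !scalerA.
rewrite mxtraceZ mxtrace1 mulfK ?pnatr_eq0 -?lt0n // invf_div mulrC.
congr (_ * _).
have cR : c^* = c.
  by apply/CrealP/ger0_real; rewrite /c root_double invr_ge0 sqrtC_ge0 ltW.
by rewrite cR -expr2 /c root_double exprVn sqrtCK.
Qed.

End Attainment.

End Optimum.

(** * Optimality for the random block model *)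

Theorem proposition1 (R : realType) (d : measure_display)
    (T : measurableType d) (Pr : probability T R)
    (M K P : nat) (M_gt0 : (0 < M)%N) (leMP : (M <= P)%N) (leMK : (M <= K)%N)
    (p0 : R) (p0_gt0 : 0 < p0)
    (H : 'M[R[i]]_(P, K)) (rankH : (M <= \rank H)%N)
    (Rvv : 'M[R[i]]_P) (Rvv_pd : posdefmx Rvv)
    (s : T -> 'cV[R[i]]_M) (v : T -> 'cV[R[i]]_P)
    (s_L2 : L2_cvector Pr s) (v_L2 : L2_cvector Pr v)
    (Ess : corrmx Pr s s = 1%:M) (Esv : corrmx Pr s v = 0)
    (Evv : corrmx Pr v v = Rvv)
    (V : 'M[R[i]]_K) (lam : seq R[i])
    (evd : is_evd (H ^t* *m invmx Rvv *m H) V lam) :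
  let p0C : R[i] := real_complex R p0 in
  let prodlam : R[i] := \prod_(i < M) lam`_i in
  let bound : R[i] := M%:R / p0C * (M.-root prodlam)^-1 in
  let VM : 'M[R[i]]_(K, M) :=
    \matrix_(i < K, j < M) V i (widen_ord leMK j) in
  let gam : seq R[i] := [seq sqrtC x | x <- take M lam] in
  let Gam : 'M[R[i]]_M := diag_seq M gam in
  [/\ (* [bound] is a lower bound on the arithmetic mean-square error *)
      forall (F : 'M[R[i]]_(K, M)) (B : 'M[R[i]]_M) (W : 'M[R[i]]_(M, P)),
        zf_bdfd H p0C F B W -> bound <= arith_mse Pr s v H F B W,
      (* the algorithm and the QR decomposition do produce an output *)
      exists Psi Q Ubar : 'M[R[i]]_M,
        algorithmA gam Psi /\ is_qr (Gam *m Psi) Q Ubar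
    & (* every such output yields a transceiver attaining [bound] *)
      forall Psi Q Ubar : 'M[R[i]]_M,
        algorithmA gam Psi -> is_qr (Gam *m Psi) Q Ubar ->
        let F : 'M[R[i]]_(K, M) := sqrtC (p0C / M%:R) *: (VM *m Psi) in
        let U : 'M[R[i]]_M := ((2 * M).-root prodlam)^-1 *: Ubar in
        let B : 'M[R[i]]_M := U - 1%:M in
        let W : 'M[R[i]]_(M, P) :=
          (B + 1%:M) *m mp_pinvmx (invsqrtmx Rvv *m H *m F)
            *m invsqrtmx Rvv in
        [/\ Psi \is unitarymx,
            (forall i j : 'I_M, (j < i)%N -> U i j = 0) /\
            (forall i : 'I_M, U i i = 1),
            zf_bdfd H p0C F B W
          & arith_mse Pr s v H F B W = bound]].
Proof.
move=> p0C prodlam bound VM gam Gam.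
have p0C_gt0 : 0 < p0C by rewrite /p0C -[0]/(real_complex R 0) ltcR.
split.
- move=> F B W [B_upper trF zf].
  rewrite (arith_mse_zf s v_L2 zf) Evv.
  apply: (zf_mse_ge M_gt0 leMK p0C_gt0 Rvv_pd evd trF).
  by rewrite zf det_strict_upperD1.
- exact: (algorithmA_qr_exists M_gt0 leMK rankH Rvv_pd evd).
- move=> Psi Q Ubar PsiA QR F U B W.
  have zf := optimal_zf_bdfd M_gt0 leMK p0C_gt0 rankH Rvv_pd evd PsiA QR.
  split=> //.
  + exact: (Psi_unitary M_gt0 leMK rankH Rvv_pd evd PsiA).
  + exact: (U_upper_unit M_gt0 leMK rankH Rvv_pd evd PsiA QR).
  + rewrite (arith_mse_zf s v_L2); last by case: zf.
    rewrite Evv.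
    exact: (optimal_mse M_gt0 leMK p0C_gt0 rankH Rvv_pd evd PsiA QR).
Qed.
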